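(* Let $n\ge 1$ and let $f,g\in\mathscr{S}=\mathscr{S}(\mathbb{R}^n,\mathbb{R})$. Then $$\frac{1}{\sqrt{(2\pi)^n}}\,\mathscr{F}_{\mathbb{R}}[f\ast g]=\frac12\Big(\mathscr{F}_{\mathbb{R}}[f]\cdot\mathscr{F}_{\mathbb{R}}[g]+\mathscr{F}_{\mathbb{R}}[f]\cdot P\mathscr{F}_{\mathbb{R}}[g]+P\mathscr{F}_{\mathbb{R}}[f]\cdot\mathscr{F}_{\mathbb{R}}[g]-P\mathscr{F}_{\mathbb{R}}[f]\cdot P\mathscr{F}_{\mathbb{R}}[g]\Big)$$ and $$\mathscr{F}_{\mathbb{R}}[f\cdot g]=\frac{1}{\sqrt{(2\pi)^n}}\,\frac12\Big(\mathscr{F}_{\mathbb{R}}[f]\ast\mathscr{F}_{\mathbb{R}}[g]+\mathscr{F}_{\mathbb{R}}[f]\ast P\mathscr{F}_{\mathbb{R}}[g]+P\mathscr{F}_{\mathbb{R}}[f]\ast\mathscr{F}_{\mathbb{R}}[g]-P\mathscr{F}_{\mathbb{R}}[f]\ast P\mathscr{F}_{\mathbb{R}}[g]\Big).$$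
   Context: $\mathscr{S}=\mathscr{S}(\mathbb{R}^n,\mathbb{R})$ is the real vector space of real-valued Schwartz functions on $\mathbb{R}^n$. The real Fourier transform is the linear operator $\mathscr{F}_{\mathbb{R}}:\mathscr{S}\to\mathscr{S}$, $$\mathscr{F}_{\mathbb{R}}[f](\mathbf{y})=\frac{1}{\sqrt{(2\pi)^n}}\int_{\mathbb{R}^n} f(\mathbf{x})\big(\cos(\mathbf{y}\cdot\mathbf{x})-\sin(\mathbf{y}\cdot\mathbf{x})\big)\,d\mathbf{x},$$ where $\mathbf{y}\cdot\mathbf{x}$ is the Euclidean inner product of vectors. Between functions, the central dot denotes the point-wise product. The convolution is $(f\ast g)(\mathbf{x})=\int_{\mathbb{R}^n} f(\mathbf{x}-\mathbf{y})\,g(\mathbf{y})\,d\mathbf{y}$. The parity operator $P:\mathscr{S}\to\mathscr{S}$ is $P[f](\mathbf{x})=f(-\mathbf{x})$, and $P\mathscr{F}_{\mathbb{R}}$ denotes the composition $P\circ\mathscr{F}_{\mathbb{R}}$. *)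

(* Defs.v *)
From HB Require Import structures.
From mathcomp Require Import all_boot all_order all_algebra.
From mathcomp Require Import all_classical all_reals all_analysis.

Set Implicit Arguments.
Unset Strict Implicit.
Unset Printing Implicit Defensive.
Import Order.TTheory GRing.Theory Num.Theory.
Import numFieldNormedType.Exports.

Local Open Scope classical_set_scope.
Local Open Scope ring_scope.

(* The sigma-algebra on T^n is the one generated by the coordinates, exactly
   as for [n.-tuple T]; for T = R it is the Borel sigma-algebra of R^n. *)
Definition measure_rV_display : measure_display -> measure_display.
Proof. exact. Qed.

Section measurable_rV.
Context {d} {T : measurableType d}.
Variable n : nat.

Let coord : 'I_n -> 'rV[T]_n -> T := fun j x => x ord0 j.

Let rV_set0 : g_sigma_preimage coord set0.
Proof. exact: sigma_algebra0. Qed.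

Let rV_setC A : g_sigma_preimage coord A -> g_sigma_preimage coord (~` A).
Proof. exact: sigma_algebraC. Qed.

Let rV_bigcup (F : _^nat) : (forall i, g_sigma_preimage coord (F i)) ->
  g_sigma_preimage coord (\bigcup_i (F i)).
Proof. exact: sigma_algebra_bigcup. Qed.

HB.instance Definition _ := @isMeasurable.Build (measure_rV_display d)
  'rV[T]_n (g_sigma_preimage coord) rV_set0 rV_setC rV_bigcup.

Lemma measurable_coord (j : 'I_n) :
  measurable_fun [set: 'rV[T]_n] (fun x : 'rV[T]_n => x ord0 j).
Proof.
move=> _ Y mY; rewrite setTI; apply: sub_sigma_algebra => /=.
rewrite -bigcup_seq/=; exists j; first by rewrite /= mem_index_enum.
by exists Y => //; rewrite setTI.
Qed.

Lemma measurable_fun_rVP d1 (T1 : measurableType d1) (f : T1 -> 'rV[T]_n) :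
  measurable_fun [set: T1] f <->
  forall j, measurable_fun [set: T1] (fun x => f x ord0 j).
Proof.
split=> [mf j|mf].
  exact: (measurableT_comp (measurable_coord j) mf).
have mC : sigma_algebra setT [set A | @measurable _ T1 (f @^-1` A)].
  split=> [|A mA|F mF] /=.
  - by rewrite preimage_set0.
  - by rewrite setTD -preimage_setC; exact: measurableC.
  - by rewrite preimage_bigcup; apply: bigcup_measurable => k _; exact: mF.
move=> _ A mA; rewrite setTI.
apply: (mA [set A | @measurable _ T1 (f @^-1` A)]); split => // B.
rewrite -bigcup_seq => -[j _ [C mC' <-]] /=; rewrite setTI.
by have := mf j measurableT C mC'; rewrite setTI.
Qed.

End measurable_rV.

Section lebesgue_rV.
Context {R : realType}.

Section cons.
Variable n : nat.

Definition rV_cons (p : measurableTypeR R * 'rV[R]_n) : 'rV[R]_n.+1 :=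
  row_mx (p.1 : R)%:M p.2 : 'rV[R]_(1 + n).

Lemma rV_cons0 p : rV_cons p ord0 ord0 = p.1.
Proof. by rewrite mxE; case: splitP => // j _; rewrite mxE (ord1 j). Qed.

Lemma rV_consS p j : rV_cons p ord0 (lift ord0 j) = p.2 ord0 j.
Proof.
by rewrite mxE; case: splitP => [k|k [/val_inj ->]//]; rewrite (ord1 k).
Qed.

Lemma measurable_rV_cons : measurable_fun [set: _] rV_cons.
Proof.
apply/measurable_fun_rVP => j.
case: (unliftP ord0 j) => [k ->|->].
  under eq_fun do rewrite rV_consS.
  exact: (measurableT_comp (measurable_coord k) measurable_snd).
under eq_fun do rewrite rV_cons0.
exact: measurable_fst.
Qed.

Definition rV_uncons (x : 'rV[R]_n.+1) : measurableTypeR R * 'rV[R]_n :=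
  (x ord0 ord0, \row_j x ord0 (lift ord0 j)).

Lemma rV_consK : cancel rV_cons rV_uncons.
Proof.
move=> [a x]; rewrite /rV_uncons rV_cons0; congr pair.
by apply/rowP => j; rewrite mxE rV_consS.
Qed.

Lemma rV_unconsK : cancel rV_uncons rV_cons.
Proof.
move=> x; apply/rowP => j; case: (unliftP ord0 j) => [k ->|->].
  by rewrite rV_consS mxE.
by rewrite rV_cons0.
Qed.

Lemma measurable_rV_uncons : measurable_fun [set: _] rV_uncons.
Proof.
apply/measurable_fun_pairP; split => /=.
  exact: (measurable_coord (ord0 : 'I_n.+1)).
apply/measurable_fun_rVP => j.
under eq_fun do rewrite mxE.
exact: (measurable_coord (lift ord0 j)).
Qed.

Variable mu : {sigma_finite_measure set 'rV[R]_n -> \bar R}.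

Definition lebesgue_cons : set 'rV[R]_n.+1 -> \bar R :=
  pushforward (lebesgue_measure \x mu)%E rV_cons.

Let lebesgue_cons0 : lebesgue_cons set0 = 0%E.
Proof. by rewrite /lebesgue_cons /pushforward preimage_set0 measure0. Qed.

Let lebesgue_cons_ge0 A : (0 <= lebesgue_cons A)%E.
Proof. exact: (@measure_ge0 _ _ _ (lebesgue_measure \x mu)%E). Qed.

Let lebesgue_cons_sigma_additive : semi_sigma_additive lebesgue_cons.
Proof.
have mf := measurable_rV_cons; exact: measure_semi_sigma_additive.
Qed.

HB.instance Definition _ := isMeasure.Build _ _ _ lebesgue_cons
  lebesgue_cons0 lebesgue_cons_ge0 lebesgue_cons_sigma_additive.

Let lebesgue_cons_sigma_finite : sigma_finite setT lebesgue_cons.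
Proof.
have /sigma_finiteP[F [TF ndF Foo]] := sigma_finiteT (@lebesgue_measure R).
have /sigma_finiteP[G [TG ndG Goo]] := sigma_finiteT mu.
exists (fun k => rV_uncons @^-1` (F k `*` G k)).
  rewrite -preimage_bigcup (_ : \bigcup_k (F k `*` G k) = setT) ?preimage_setT//.
  rewrite -setXTT TF TG predeqE => -[x y]; split.
    by move=> [k _ [Fkx Gky]]; split; exists k.
  move=> [/= [k _ Fkx] [l _ Gly]]; exists (maxn k l) => //; split.
    by move: x Fkx; exact/subsetPset/ndF/leq_maxl.
  by move: y Gly; exact/subsetPset/ndG/leq_maxr.
move=> k; have [mF Fk] := Foo k; have [mG Gk] := Goo k; split.
  rewrite -[X in measurable X]setTI; apply: measurable_rV_uncons => //.
  exact: measurableX.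
rewrite /lebesgue_cons /pushforward -comp_preimage.
rewrite (_ : _ \o _ = id) ?preimage_id; last by apply/funext => p; exact: rV_consK.
by rewrite product_measure1E// lte_mul_pinfty// ge0_fin_numE.
Qed.

HB.instance Definition _ := Measure_isSigmaFinite.Build _ _ _ lebesgue_cons
  lebesgue_cons_sigma_finite.

End cons.

Fixpoint lebesgue_rV n : {sigma_finite_measure set 'rV[R]_n -> \bar R} :=
  if n is m.+1 then lebesgue_cons (lebesgue_rV m) else \d_(0 : 'rV[R]_0).

Lemma measurable_rV_box n (A : 'I_n -> set R) : (forall j, measurable (A j)) ->
  measurable [set x : 'rV[R]_n | forall j, A j (x ord0 j)].
Proof.
move=> mA.
rewrite (_ : [set _ | _] = \bigcap_(j in [set: 'I_n])
    ((fun x : 'rV[R]_n => x ord0 j) @^-1` A j)); last first.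
  by apply/seteqP; split=> [x + j _|x + j]; [exact|exact].
apply: fin_bigcap_measurable => // j _.
by rewrite -[X in measurable X]setTI; exact: measurable_coord.
Qed.

Lemma lebesgue_rV_box n (A : 'I_n -> set R) : (forall j, measurable (A j)) ->
  lebesgue_rV n [set x | forall j, A j (x ord0 j)] =
  (\prod_(j < n) lebesgue_measure (A j))%E.
Proof.
elim: n A => [|n IH] A mA.
  by rewrite big_ord0 /= diracE mem_set// => -[].
rewrite big_ord_recl -IH//= /lebesgue_cons /pushforward.
have mB := @measurable_rV_box n (fun j => A (lift ord0 j)) (fun=> mA _).
set B := [set x | _] in mB *.
rewrite -(product_measure1E lebesgue_measure (lebesgue_rV n) (mA ord0) mB).
congr (_ _); apply/seteqP; split=> [p Ap|p [A0 AS] j] /=.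
  by split=> [|j]; rewrite /= -?(rV_cons0 p) -?(rV_consS p); exact: Ap.
by case: (unliftP ord0 j) => [k ->|->]; rewrite ?rV_consS ?rV_cons0//; exact: AS.
Qed.

End lebesgue_rV.

Section fourier.
Context {R : realType} {n : nat}.
Implicit Types f g : 'rV[R]_n -> R.

(* The iterated partial derivative of f along the coordinates listed in s;
   every multi-index derivative is obtained by listing each coordinate with its
   multiplicity. *)
Definition partials (s : seq 'I_n) f : 'rV[R]_n -> R :=
  foldr (fun i g => 'D_(delta_mx ord0 i) g) f s.

Definition smooth f := forall s : seq 'I_n,
  continuous (partials s f) /\
  forall x i, derivable (partials s f) x (delta_mx ord0 i).

Definition schwartz : set ('rV[R]_n -> R) :=
  [set f | smooth f /\
    forall (a : 'I_n -> nat) (s : seq 'I_n), exists M : R,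
      forall x : 'rV[R]_n, `|(\prod_(i < n) x ord0 i ^+ a i) * partials s f x| <= M].

Definition dot (y x : 'rV[R]_n) : R := \sum_(i < n) y ord0 i * x ord0 i.

Definition real_fourier f : 'rV[R]_n -> R := fun y =>
  (Num.sqrt ((2 * pi) ^+ n))^-1 *
  \int[lebesgue_rV n]_x (f x * (cos (dot y x) - sin (dot y x))).

Definition convolution f g : 'rV[R]_n -> R := fun x =>
  \int[lebesgue_rV n]_y (f (x - y) * g y).

Definition parity f : 'rV[R]_n -> R := fun x => f (- x).

End fourier.

(* Main.v *)
(* Write cas = cos - sin. The first identity is Fubini, translation invariance and
   the addition formula for cas.

   For the second, substitute g = F(F g) in the integral defining F(f g), exchange
   the integrals and use 2 cas a cas b = cas(b - a) + cas(a - b) + cas(a + b) - cas(- a - b).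
   This only requires that F is an involution on Schwartz functions and that F g is
   integrable. Integrability follows from F g = O(prod_i (1 + y_i^2)^-1), obtained by
   integrating by parts twice in each coordinate. Inversion is proved with the Abel
   means prod_i exp(- e |t_i|): their cosine transform is the Poisson kernel
   prod_i 2 e / (e^2 + z_i^2), elementary in dimension one, and e -> 0 by dominated
   convergence. *)
Require Import Defs.
From mathcomp Require Import all_boot all_order all_algebra.
From mathcomp Require Import all_classical all_reals all_analysis.
From mathcomp Require Import measurable_realfun ring lra.

Set Implicit Arguments.
Unset Strict Implicit.
Unset Printing Implicit Defensive.
Import Order.TTheory GRing.Theory Num.Theory.
Import numFieldNormedType.Exports.

Local Open Scope classical_set_scope.
Local Open Scope ring_scope.

(** * Integration *)

(** A real kernel can invert itself because [cas a * cas b = cos (a - b) - sin (a + b)]: against an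
    even function of the integration variable the sine term integrates to 0, and what is left
    depends only on the difference of the two points. Exponentials serve better than Gaussians here
    because their transform has an explicit antiderivative. By homogeneity the Poisson kernel is
    [(2 / e) ^+ n * weight (e^-1 *: z)], so one function, [weight], is both the integrable majorant
    for decay and the approximate identity, and its integral [pi ^+ n] supplies the normalising
    constant. The real-valued integral is the finite part of an extended one and is not linear
    without integrability, hence the recurring side conditions. Fubini is stated for functions all
    of whose sections are integrable; boundedness of one factor is often what provides this. *)

Section integration.
Context d (T : measurableType d) (R : realType).
Variable mu : {measure set T -> \bar R}.
Implicit Types f g : T -> R.

Lemma integrable_dominated f g : measurable_fun setT f ->
  mu.-integrable setT (EFin \o g) -> (forall x, `|f x| <= g x) ->
  mu.-integrable setT (EFin \o f).
Proof.
move=> mf ig fg; apply: le_integrable ig => //; first exact/measurable_EFinP.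
by move=> x _ /=; rewrite lee_fin (le_trans (fg x))// ler_norm.
Qed.

Lemma integrable_measurable f : mu.-integrable setT (EFin \o f) ->
  measurable_fun setT f.
Proof. by move=> /integrableP[/measurable_EFinP]. Qed.

Lemma integrable_normr f : mu.-integrable setT (EFin \o f) ->
  mu.-integrable setT (EFin \o (fun x => `|f x|)).
Proof. by move=> /(integrable_norm). Qed.

Lemma integrable_mulr_bounded f g M : mu.-integrable setT (EFin \o f) ->
  measurable_fun setT g -> (forall x, `|g x| <= M) ->
  mu.-integrable setT (EFin \o (fun x => f x * g x)).
Proof.
move=> fi mg gM; have mf := integrable_measurable fi.
apply: (@integrable_dominated _ (fun x => M * `|f x|)).
- exact: measurable_funM.
- apply: eq_integrable (integrableZl measurableT M (integrable_normr fi)) => //.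
- by move=> x; rewrite normrM mulrC ler_wpM2r.
Qed.

Lemma EFin_Rintegral f : mu.-integrable setT (EFin \o f) ->
  (\int[mu]_x f x)%:E = (\int[mu]_x (f x)%:E)%E.
Proof. by move=> fi; rewrite fineK//; exact: integrable_fin_num. Qed.

Lemma cvg_Rintegral_dominated (f_ : (T -> R)^nat) f g :
  (forall n, measurable_fun setT (f_ n)) ->
  (forall x, f_ ^~ x @ \oo --> f x) ->
  mu.-integrable setT (EFin \o g) -> (forall n x, `|f_ n x| <= g x) ->
  (\int[mu]_x f_ n x) @[n --> \oo] --> \int[mu]_x f x.
Proof.
move=> mf_ cf ig fg.
have mf : measurable_fun setT f.
  by apply: (measurable_fun_cvg mf_) => x _; exact: cf.
have ae_cvg : {ae mu, forall x, setT x -> (fun n => (f_ n x)%:E) @ \oo --> (f x)%:E}.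
  apply/aeW => x _; apply/cvg_EFin; first exact: nearW.
  exact: cf.
have ae_le : {ae mu, forall x n, setT x -> (`|(f_ n x)%:E| <= (g x)%:E)%E}.
  by apply/aeW => x n _; rewrite lee_fin.
have [||fi _ c] := dominated_convergence measurableT _ _ ae_cvg ig ae_le.
- by move=> n; exact/measurable_EFinP.
- exact/measurable_EFinP.
- by rewrite -EFin_Rintegral// in c; exact: fine_cvg c.
Qed.

End integration.

(** * Fubini's theorem and tensor products *)

Section product.
Context d1 d2 (T1 : measurableType d1) (T2 : measurableType d2) (R : realType).
Variable m1 : {sigma_finite_measure set T1 -> \bar R}.
Variable m2 : {sigma_finite_measure set T2 -> \bar R}.

Section fubini.
Variable f : T1 * T2 -> R.
Hypothesis fi : (m1 \x m2)%E.-integrable setT (EFin \o f).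
Hypothesis fi2 : forall x, m2.-integrable setT (EFin \o (fun y => f (x, y))).

(** Integrability on the product only controls almost every section. Since [fi2] covers every
    section, the inner real integral equals the extended one at each point and no null set has to be
    carried along. *)
Lemma integrable_Rintegral2 :
  m1.-integrable setT (EFin \o (fun x => \int[m2]_y f (x, y))).
Proof.
apply: eq_integrable (integrable_fubini_F fi) => // x _ /=.
by rewrite EFin_Rintegral//; exact: fi2.
Qed.

Lemma Rintegral12 : \int[m1]_x \int[m2]_y f (x, y) = \int[(m1 \x m2)%E]_z f z.
Proof.
rewrite /Rintegral -(integral12_prod_meas1 fi); congr fine.
by apply: eq_integral => x _; rewrite EFin_Rintegral.
Qed.

Hypothesis fi1 : forall y, m1.-integrable setT (EFin \o (fun x => f (x, y))).

Lemma Rintegral_Fubini :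
  \int[m1]_x \int[m2]_y f (x, y) = \int[m2]_y \int[m1]_x f (x, y).
Proof.
rewrite Rintegral12 /Rintegral -(integral21_prod_meas1 fi); congr fine.
by apply: eq_integral => x _; rewrite [RHS]EFin_Rintegral//; exact: fi1.
Qed.

End fubini.

Variables (f : T1 -> R) (g : T2 -> R).
Hypothesis fi : m1.-integrable setT (EFin \o f).
Hypothesis gi : m2.-integrable setT (EFin \o g).

Lemma integrable_tensor :
  (m1 \x m2)%E.-integrable setT (EFin \o (fun z => f z.1 * g z.2)).
Proof.
have mf := integrable_measurable fi; have mg := integrable_measurable gi.
apply/integrable12ltyP.
  apply/measurable_EFinP; apply: measurable_funM.
    exact: (measurableT_comp mf measurable_fst).
  exact: (measurableT_comp mg measurable_snd).
have ng : (\int[m2]_y `|(g y)%:E|)%E \is a fin_num.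
  by rewrite ge0_fin_numE ?integral_ge0//; case/integrableP : gi.
rewrite (eq_integral (fun x => (\int[m2]_y `|(g y)%:E|) * `|(f x)%:E|)%E).
  rewrite ge0_integralZl//.
  - apply: lte_mul_pinfty => //; first exact: integral_ge0.
    by case/integrableP : fi.
  - by apply: measurableT_comp => //; exact/measurable_EFinP.
  - exact: integral_ge0.
move=> x _ /=; rewrite muleC -ge0_integralZl//.
- by apply: eq_integral => y _; rewrite normrM EFinM.
- by apply/measurable_EFinP; exact: measurableT_comp.
Qed.

Lemma Rintegral_tensor :
  \int[(m1 \x m2)%E]_z (f z.1 * g z.2) = (\int[m1]_x f x) * (\int[m2]_y g y).
Proof.
rewrite -(Rintegral12 integrable_tensor) => [|x]; last first.
  by apply: eq_integrable (integrableZl measurableT (f x) gi).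
rewrite -RintegralZr//; apply: eq_Rintegral => x _ /=.
exact: RintegralZl.
Qed.

End product.

(** * Lebesgue measure on row vectors *)

Section continuous_rV.
Context {R : realType} {n : nat}.

(** The sigma-algebra is generated by coordinates, so an open set is written as a countable union of
    the boxes with rational centre and half-side [k.+1%:R^-1] that it contains; all other indices
    contribute the empty set. *)
Lemma open_measurable_rV (O : set 'rV[R]_n) : open O -> measurable O.
Proof.
move=> oO.
pose box (i : nat * 'rV[rat]_n) : set 'rV[R]_n := [set x | forall j,
  `]ratr (i.2 ord0 j) - i.1.+1%:R^-1, ratr (i.2 ord0 j) + i.1.+1%:R^-1[%classic
    (x ord0 j)].
pose F i : set 'rV[R]_n := if `[< box i `<=` O >] then box i else set0.
rewrite (_ : O = \bigcup_i F i).
  apply: countable_bigcupT_measurable; first exact: countableP.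
  move=> i; rewrite /F; case: ifPn => _ //.
  exact: (measurable_rV_box (A := fun j =>
    `]ratr (i.2 ord0 j) - i.1.+1%:R^-1, ratr (i.2 ord0 j) + i.1.+1%:R^-1[%classic)).
apply/seteqP; split=> [x Ox|x [i _]]; last first.
  by rewrite /F; case: asboolP => // bO /bO.
have /nbhs_ballP[e /= e0 eO] := oO _ Ox.
(* A box of half-side 1/(k+1) has side 2/(k+1) < e, so if it contains [x] it lies in the sup-norm
   ball of radius [e] around [x]. *)
pose k := Num.truncn (2 / e).
have ke : 2 / k.+1%:R < e.
  by rewrite ltr_pdivrMr// mulrC -ltr_pdivrMr// truncnS_gt.
have k0 : 0 < k.+1%:R^-1 :> R by rewrite invr_gt0.
have /all_sig2[q q1 q2] : forall j,
    {q : rat | x ord0 j < ratr q & ratr q < x ord0 j + k.+1%:R^-1}.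
  move=> j; apply/cid2.
  have /rat_in_itvoo[q] : x ord0 j < x ord0 j + k.+1%:R^-1 by rewrite ltrDl.
  by rewrite in_itv/= => /andP[? ?]; exists q.
exists (k, \row_j q j) => //; rewrite /F asboolT.
  move=> j; rewrite /= in_itv/= mxE; move: (k.+1%:R^-1) q2 => r q2.
  have := q1 j; have := q2 j => *; apply/andP; split; lra.
move=> y /= By; apply: eO; split=> // i j; rewrite (ord1 i).
have := By j; rewrite /= in_itv/= mxE => /andP[y1 y2].
rewrite /ball/= ltr_norml; move: ke y1 y2 q2; rewrite -[2 / _]/(2 * _).
move: (k.+1%:R^-1) => r ke y1 y2 q2; have := q1 j; have := q2 j => *.
by apply/andP; split; lra.
Qed.

Lemma continuous_measurable_rV (f : 'rV[R]_n -> R) :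
  continuous f -> measurable_fun setT f.
Proof.
move=> /continuousP cf; apply: (measurability _ (RGenOpens.measurableE R)).
move=> _ [_ [a [b ->] <-]]; rewrite setTI; apply: open_measurable_rV.
exact/cf/interval_open.
Qed.

End continuous_rV.

(** * Affine changes of variables *)

Section affine.
Context {R : realType}.
Local Notation leb := (@lebesgue_measure R).

(** By uniqueness of Lebesgue measure it suffices to compare both measures on the intervals []u,
    v]]. *)
Lemma lebesgue_measure_affine (a s : R) (A : set R) : s != 0 -> measurable A ->
  (`|s|%:E * leb ((fun x => (a + s * x)%R) @^-1` A))%E = leb A.
Proof.
move=> s0 mA; have s0' : 0 < `|s| by rewrite normr_gt0.
pose phi : measurableTypeR R -> measurableTypeR R := fun x => a + s * x.
have mphi : measurable_fun setT phi.
  by apply: measurable_funD => //; exact: measurable_funM.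
pose m := mscale (NngNum (ltW s0')) (pushforward leb phi).
rewrite -[LHS]/(m mphi A); apply/esym.
apply: (@lebesgue_measure_unique R (m mphi)) => // _ [[u v] /= _ <-].
rewrite /m /mscale/= /pushforward lebesgue_measure_itv/= lte_fin.
have : 0 < s \/ s < 0 by case: (ltgtP s 0) s0 => // ? _; [right|left].
move=> [s_gt0|s_lt0].
  rewrite (_ : phi @^-1` _ = `](u - a) / s, (v - a) / s]%classic).
    rewrite lebesgue_measure_itv/= lte_fin ltr_pM2r ?invr_gt0// ltrD2r gtr0_norm//.
    case: ifP => _; last by rewrite mule0.
    by rewrite -EFinD -EFinM; congr EFin; field; exact: lt0r_neq0.
  apply/seteqP; split=> x /=; rewrite !in_itv/= /phi ltr_pdivrMr// ler_pdivlMr//.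
    by move=> /andP[? ?]; apply/andP; split; lra.
  by move=> /andP[? ?]; apply/andP; split; lra.
(* A negative slope exchanges the endpoints, so the preimage is closed on the left and open on the
   right; its measure is still the length. *)
rewrite (_ : phi @^-1` _ = `[(v - a) / s, (u - a) / s[%classic).
  rewrite lebesgue_measure_itv/= lte_fin ltr_nM2r ?invr_lt0// ltrD2r ltr0_norm//.
  case: ifP => _; last by rewrite mule0.
  by rewrite -EFinD -EFinM; congr EFin; field; exact: ltr0_neq0.
apply/seteqP; split=> x /=; rewrite !in_itv/= /phi ltr_ndivlMr// ler_ndivrMr//.
  by move=> /andP[? ?]; apply/andP; split; lra.
by move=> /andP[? ?]; apply/andP; split; lra.
Qed.

Lemma ge0_integral_affine (a s : R) (h : measurableTypeR R -> \bar R) : s != 0 ->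
  measurable_fun setT h -> (forall x, 0 <= h x)%E ->
  (`|s|%:E * \int[leb]_x h (a + s * x)%R)%E = (\int[leb]_x h x)%E.
Proof.
move=> s0 mh h0; have s0' : 0 < `|s| by rewrite normr_gt0.
pose phi : measurableTypeR R -> measurableTypeR R := fun x => a + s * x.
have mphi : measurable_fun setT phi.
  by apply: measurable_funD => //; exact: measurable_funM.
rewrite -(ge0_integral_pushforward mphi leb (D := setT) (f := h))//.
rewrite -(ge0_integral_mscale _ measurableT (NngNum (ltW s0')))//.
apply: eq_measure_integral => A mA _.
exact: lebesgue_measure_affine.
Qed.

Lemma ge0_integral_rV_cons n (h : 'rV[R]_n.+1 -> \bar R) :
  measurable_fun setT h -> (forall x, 0 <= h x)%E ->
  (\int[lebesgue_rV n.+1]_x h x)%E =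
  (\int[leb]_a \int[lebesgue_rV n]_x h (rV_cons (a, x)))%E.
Proof.
move=> mh h0; rewrite /= /lebesgue_cons ge0_integral_pushforward//.
  rewrite fubini_tonelli1//=.
  by apply: measurableT_comp => //; exact: measurable_rV_cons.
exact: measurable_rV_cons.
Qed.

Lemma measurable_affine_rV n (a : 'rV[R]_n) (s : R) :
  measurable_fun setT (fun x : 'rV[R]_n => a + s *: x).
Proof.
apply/measurable_fun_rVP => j; under eq_fun do rewrite !mxE.
apply: measurable_funD => //; apply: measurable_funM => //.
exact: measurable_coord.
Qed.

(** Induction on the dimension: Tonelli splits off the first coordinate, to which the
    one-dimensional formula applies, and each split contributes one factor [|s|]. Keeping [a] and
    [s] together covers translations, reflections and the dilation of the Poisson kernel at once. *)
Lemma ge0_integral_affine_rV n (a : 'rV[R]_n) (s : R) (h : 'rV[R]_n -> \bar R) :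
  s != 0 -> measurable_fun setT h -> (forall x, 0 <= h x)%E ->
  ((`|s| ^+ n)%:E * \int[lebesgue_rV n]_x h (a + s *: x)%R)%E =
  (\int[lebesgue_rV n]_x h x)%E.
Proof.
move=> s0; elim: n a h => [|n IH] a h mh h0.
  rewrite expr0 mul1e; apply: eq_integral => x _.
  by congr h; apply/rowP => -[].
have mhc := measurableT_comp mh (@measurable_rV_cons R n).
rewrite !ge0_integral_rV_cons//; last first.
  exact: (measurableT_comp mh (@measurable_affine_rV _ a s)).
pose H b := (\int[lebesgue_rV n]_x h (rV_cons (b, x)))%E.
have mH : measurable_fun setT H.
  apply: (@measurable_fun_fubini_tonelli_F _ _ _ _ R _ (h \o @rV_cons R n)) => //.
  by move=> ?; exact: h0.
have H0 b : (0 <= H b)%E by exact: integral_ge0.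
rewrite -[RHS]/(\int[leb]_b H b)%E -[RHS](ge0_integral_affine (a ord0 ord0) s0 mH H0).
rewrite exprS EFinM -muleA; congr (_ * _)%E.
rewrite -ge0_integralZl//; last 2 first.
- apply: (@measurable_fun_fubini_tonelli_F _ _ _ _ R _
    (h \o (fun x => a + s *: x) \o @rV_cons R n)) => [|? /=]; last exact: h0.
  apply: measurableT_comp; last exact: measurable_rV_cons.
  exact: (measurableT_comp mh (@measurable_affine_rV _ a s)).
- by move=> b _; exact: integral_ge0.
apply: eq_integral => b _.
rewrite /H -(IH (\row_j a ord0 (lift ord0 j)) (fun x => h (rV_cons (_, x))))//.
  congr (_ * _)%E; apply: eq_integral => x _; congr h; apply/rowP => j.
  rewrite 2!mxE; case: (unliftP ord0 j) => [k ->|->].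
    by rewrite !rV_consS !mxE.
  by rewrite !rV_cons0.
exact: (measurableT_comp mhc (measurable_pair1 _)).
Qed.

Variables (n : nat) (a : 'rV[R]_n) (s : R) (h : 'rV[R]_n -> R).
Hypotheses (s0 : s != 0) (ih : (lebesgue_rV n).-integrable setT (EFin \o h)).

Lemma integrable_affine_rV :
  (lebesgue_rV n).-integrable setT (EFin \o (fun x => h (a + s *: x))).
Proof.
have mh := integrable_measurable ih.
apply/integrableP; split.
  apply/measurable_EFinP; exact: (measurableT_comp mh (@measurable_affine_rV _ a s)).
case/integrableP : ih => _; rewrite -(@ge0_integral_affine_rV n a s)//=; last first.
  by apply/measurable_EFinP; exact: measurableT_comp.
have sn : 0 < `|s| ^+ n by rewrite exprn_gt0// normr_gt0.
rewrite !ltey; apply: contra_neq => ->.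
by rewrite gt0_muley// lte_fin.
Qed.

Lemma Rintegral_affine_rV :
  `|s| ^+ n * \int[lebesgue_rV n]_x h (a + s *: x) = \int[lebesgue_rV n]_x h x.
Proof.
have mh : measurable_fun setT (EFin \o h) by apply/measurable_EFinP/integrable_measurable/ih.
apply: EFin_inj; rewrite EFinM !EFin_Rintegral//; last exact: integrable_affine_rV.
rewrite integralE [RHS]integralE (funepos_comp (EFin \o h) (fun x => a + s *: x)).
rewrite (funeneg_comp (EFin \o h) (fun x => a + s *: x)).
rewrite -(@ge0_integral_affine_rV n a s (EFin \o h)^\+%E)//; last exact: measurable_funepos.
rewrite -(@ge0_integral_affine_rV n a s (EFin \o h)^\-%E)//; last exact: measurable_funeneg.
rewrite muleBr//.
(* Distributing the factor over the difference of positive and negative parts requires excluding the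
   form oo - oo; the negative part has a finite integral. *)
apply: fin_num_adde_defl; rewrite fin_numN.
apply: integrable_fin_num => //.
rewrite -/((EFin \o h)^\- \o (fun x => a + s *: x)%R)%E -funeneg_comp.
exact: (integrable_funeneg measurableT integrable_affine_rV).
Qed.

End affine.

Section reflection_translation.
Context {R : realType} {n : nat}.
Variables (t : 'rV[R]_n) (h : 'rV[R]_n -> R).
Hypothesis ih : (lebesgue_rV n).-integrable setT (EFin \o h).

Lemma integrable_translate :
  (lebesgue_rV n).-integrable setT (EFin \o (fun x => h (x + t))).
Proof.
apply: eq_integrable (integrable_affine_rV t (oner_neq0 R) ih) => // x _ /=.
by rewrite scale1r addrC.
Qed.

Lemma Rintegral_translate :
  \int[lebesgue_rV n]_x h (x + t) = \int[lebesgue_rV n]_x h x.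
Proof.
rewrite -(Rintegral_affine_rV t (oner_neq0 R) ih) normr1 expr1n mul1r.
by apply: eq_Rintegral => x _; rewrite scale1r addrC.
Qed.

Lemma integrable_reflect :
  (lebesgue_rV n).-integrable setT (EFin \o (fun x => h (t - x))).
Proof.
have N0 : -1 != 0 :> R by rewrite oppr_eq0 oner_neq0.
apply: eq_integrable (integrable_affine_rV t N0 ih) => // x _ /=.
by rewrite scaleN1r.
Qed.

Lemma Rintegral_reflect :
  \int[lebesgue_rV n]_x h (t - x) = \int[lebesgue_rV n]_x h x.
Proof.
have N0 : -1 != 0 :> R by rewrite oppr_eq0 oner_neq0.
rewrite -(Rintegral_affine_rV t N0 ih) normrN1 expr1n mul1r.
by apply: eq_Rintegral => x _; rewrite scaleN1r.
Qed.

End reflection_translation.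

(** * Product integrands in n variables *)

Section cons_integral.
Context {R : realType}.
Local Notation leb := (@lebesgue_measure R).
Local Notation mu := lebesgue_rV.

Lemma measurable_rV0 d (T : measurableType d) (f : 'rV[R]_0 -> T) :
  measurable_fun setT f.
Proof.
have -> : f = cst (f 0) by apply/funext => x; rewrite (thinmx0 x).
exact: measurable_cst.
Qed.

Lemma integrable_rV0 (f : 'rV[R]_0 -> R) : (mu 0).-integrable setT (EFin \o f).
Proof.
apply/integrableP; split; first exact: measurable_rV0.
rewrite integral_dirac//; last exact: measurable_rV0.
by rewrite diracT mul1e ltry.
Qed.

Lemma Rintegral_rV0 (f : 'rV[R]_0 -> R) : \int[mu 0]_x f x = f 0.
Proof.
rewrite /Rintegral integral_dirac ?diracT ?mul1e//.
exact: measurable_rV0.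
Qed.

Section tensor.
Variables (n : nat) (k : measurableTypeR R -> R) (f : 'rV[R]_n -> R).
Hypotheses (ik : leb.-integrable setT (EFin \o k))
  (fi : (mu n).-integrable setT (EFin \o f)).
Let kf (x : 'rV[R]_n.+1) := k (x ord0 ord0) * f (\row_j x ord0 (lift ord0 j)).

Let kf_cons p : kf (rV_cons p) = k p.1 * f p.2.
Proof.
rewrite /kf rV_cons0; congr (_ * f _).
by apply/rowP => j; rewrite mxE rV_consS.
Qed.

Let mkf : measurable_fun setT kf.
Proof.
have mk := integrable_measurable ik; have mf := integrable_measurable fi.
have mu' := @measurable_rV_uncons R n.
apply: measurable_funM.
  exact: (measurableT_comp mk (measurable_coord ord0)).
exact: (measurableT_comp mf (measurableT_comp measurable_snd mu')).
Qed.

Lemma integrable_rV_tensor : (mu n.+1).-integrable setT (EFin \o kf).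
Proof.
apply: integrable_pushforward => //.
- exact: measurable_rV_cons.
- exact/measurable_EFinP.
- apply: eq_integrable (integrable_tensor ik fi) => // p _ /=.
  by rewrite kf_cons.
Qed.

Lemma Rintegral_rV_tensor :
  \int[mu n.+1]_x kf x = (\int[leb]_a k a) * \int[mu n]_x f x.
Proof.
rewrite -Rintegral_tensor//; congr fine; rewrite /= /lebesgue_cons.
rewrite integral_pushforward//.
- by apply: eq_integral => p _ /=; rewrite kf_cons.
- exact: measurable_rV_cons.
- exact/measurable_EFinP.
- apply: eq_integrable (integrable_tensor ik fi) => // p _ /=.
  by rewrite kf_cons.
Qed.

End tensor.

Section prod_rV.
Variable k : measurableTypeR R -> R.
Hypothesis ik : leb.-integrable setT (EFin \o k).

Lemma integrable_prod_rV n :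
  (mu n).-integrable setT (EFin \o (fun x : 'rV[R]_n => \prod_i k (x ord0 i))).
Proof.
elim: n => [|n IH]; first exact: integrable_rV0.
apply: eq_integrable (integrable_rV_tensor ik IH) => // x _ /=.
by rewrite big_ord_recl; congr (_ * _)%:E; apply: eq_bigr => i _; rewrite mxE.
Qed.

Lemma Rintegral_prod_rV n :
  \int[mu n]_x (\prod_i k (x ord0 i)) = (\int[leb]_a k a) ^+ n.
Proof.
elim: n => [|n IH]; first by rewrite Rintegral_rV0 big_ord0 expr0.
rewrite exprS -IH -Rintegral_rV_tensor//; last exact: integrable_prod_rV.
apply: eq_Rintegral => x _.
by rewrite big_ord_recl; congr (_ * _); apply: eq_bigr => i _; rewrite mxE.
Qed.

Lemma dot_recl n (z x : 'rV[R]_n.+1) : dot z x = z ord0 ord0 * x ord0 ord0 +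
  dot (\row_j z ord0 (lift ord0 j)) (\row_j x ord0 (lift ord0 j)).
Proof.
by rewrite /dot big_ord_recl; congr +%R; apply: eq_bigr => i _; rewrite !mxE.
Qed.

End prod_rV.

(** * The inner product and trigonometric integrands *)

Section dot.
Variable n : nat.
Implicit Types x y z : 'rV[R]_n.

Lemma dotC y x : dot y x = dot x y.
Proof. by apply: eq_bigr => i _; rewrite mulrC. Qed.

Lemma dotDr y x z : dot y (x + z) = dot y x + dot y z.
Proof. by rewrite -big_split; apply: eq_bigr => i _; rewrite mxE mulrDr. Qed.

Lemma dotNr y x : dot y (- x) = - dot y x.
Proof. by rewrite -sumrN; apply: eq_bigr => i _; rewrite mxE mulrN. Qed.

Lemma dotNl y x : dot (- y) x = - dot y x.
Proof. by rewrite dotC dotNr dotC. Qed.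

Lemma dotBr y x z : dot y (x - z) = dot y x - dot y z.
Proof. by rewrite dotDr dotNr. Qed.

Lemma dot_delta y (i : 'I_n) (t : R) : dot y (t *: delta_mx ord0 i) = y ord0 i * t.
Proof.
rewrite /dot (bigD1 i)//= !mxE !eqxx mulr1 big1 ?addr0// => j ji.
by rewrite !mxE (negbTE ji) mulr0 mulr0.
Qed.

Lemma measurable_dot2 d (T : measurableType d) (f g : T -> 'rV[R]_n) :
  measurable_fun setT f -> measurable_fun setT g ->
  measurable_fun setT (fun p => dot (f p) (g p)).
Proof.
move=> /measurable_fun_rVP mf /measurable_fun_rVP mg.
by apply: measurable_sum => i; exact: measurable_funM.
Qed.

Lemma measurable_cos_dot y : measurable_fun setT (fun x => cos (dot y x)).
Proof.
apply: (measurableT_comp (continuous_measurable_fun (@continuous_cos R))).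
exact: measurable_dot2.
Qed.

Lemma measurable_sin_dot y : measurable_fun setT (fun x => sin (dot y x)).
Proof.
apply: (measurableT_comp (continuous_measurable_fun (@continuous_sin R))).
exact: measurable_dot2.
Qed.

Lemma cos_norm_le1 (a : R) : `|cos a| <= 1.
Proof. by rewrite ler_norml cos_geN1 cos_le1. Qed.

Lemma sin_norm_le1 (a : R) : `|sin a| <= 1.
Proof. by rewrite ler_norml sin_geN1 sin_le1. Qed.

Section trig_integrable.
Variable f : 'rV[R]_n -> R.
Hypothesis fi : (mu n).-integrable setT (EFin \o f).

Lemma integrable_cos_dot y :
  (mu n).-integrable setT (EFin \o (fun x => f x * cos (dot y x))).
Proof.
apply: (integrable_mulr_bounded fi (measurable_cos_dot y)) => x.
exact: cos_norm_le1.
Qed.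

Lemma integrable_sin_dot y :
  (mu n).-integrable setT (EFin \o (fun x => f x * sin (dot y x))).
Proof.
apply: (integrable_mulr_bounded fi (measurable_sin_dot y)) => x.
exact: sin_norm_le1.
Qed.

(** The integrand is odd, so reflection sends the integral to its negative. *)
Lemma Rintegral_even_sin_dot y : (forall x, f (- x) = f x) ->
  \int[mu n]_x (f x * sin (dot y x)) = 0.
Proof.
move=> ef; have := Rintegral_reflect 0 (integrable_sin_dot y).
under eq_Rintegral do rewrite sub0r ef dotNr sinN mulrN -mulN1r.
rewrite RintegralZl//; [lra|exact: integrable_sin_dot].
Qed.

End trig_integrable.
End dot.

(** The addition formula splits the cosine of a sum into a product of cosines minus a product of
    sines. Only the cosines survive: evenness of [k] makes the sine integral over the remaining
    coordinates vanish. *)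
Lemma Rintegral_prod_cos (k K : R -> R) :
  leb.-integrable setT (EFin \o k) -> (forall a, k (- a) = k a) ->
  (forall z, \int[leb]_a (k a * cos (z * a)) = K z) ->
  forall n (z : 'rV[R]_n),
  \int[mu n]_x ((\prod_i k (x ord0 i)) * cos (dot z x)) = \prod_i K (z ord0 i).
Proof.
move=> ik ek kK; elim=> [|n IH] z.
  by rewrite Rintegral_rV0 !big_ord0 /dot big_ord0 cos0 mulr1.
set P := fun x : 'rV[R]_n => \prod_i k (x ord0 i).
have iP : (mu n).-integrable setT (EFin \o P) by exact: integrable_prod_rV.
set z' := \row_j z ord0 (lift ord0 j).
have mc : measurable_fun setT (fun a : measurableTypeR R => cos (z ord0 ord0 * a)).
  apply: (measurableT_comp (continuous_measurable_fun (@continuous_cos R))).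
  exact: measurable_funM.
have ms : measurable_fun setT (fun a : measurableTypeR R => sin (z ord0 ord0 * a)).
  apply: (measurableT_comp (continuous_measurable_fun (@continuous_sin R))).
  exact: measurable_funM.
have ikc := integrable_mulr_bounded ik mc (fun a => cos_norm_le1 _).
have iks := integrable_mulr_bounded ik ms (fun a => sin_norm_le1 _).
have iPc := integrable_cos_dot iP z'; have iPs := integrable_sin_dot iP z'.
rewrite big_ord_recl -kK.
under [X in _ = _ * X]eq_bigr => i _.
  rewrite (_ : z ord0 (lift ord0 i) = z' ord0 i); last by rewrite mxE.
over.
rewrite -IH -Rintegral_rV_tensor// -[RHS]subr0.
(* The 0 just subtracted on the right is replaced by the vanishing sine product, so that both sides
   become a single integral compared pointwise through [cosD]. *)
have <- : \int[mu n.+1]_x (k (x ord0 ord0) * sin (z ord0 ord0 * x ord0 ord0) *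
    (P (\row_j x ord0 (lift ord0 j)) * sin (dot z' (\row_j x ord0 (lift ord0 j))))) = 0.
  rewrite (Rintegral_rV_tensor iks iPs) (Rintegral_even_sin_dot iP) ?mulr0// => x.
  by apply: eq_bigr => i _; rewrite mxE.
rewrite -RintegralB//; [|exact: integrable_rV_tensor ikc iPc|
  exact: integrable_rV_tensor iks iPs].
apply: eq_Rintegral => x _; rewrite dot_recl cosD big_ord_recl.
have -> : \prod_(i < n) k (x ord0 (lift ord0 i)) = P (\row_j x ord0 (lift ord0 j)).
  by apply: eq_bigr => i _; rewrite mxE.
by rewrite -/z' /P; ring.
Qed.

End cons_integral.

(** * The Abel kernel *)

Section one_dimensional_kernels.
Context {R : realType}.
Local Notation leb := (@lebesgue_measure R).
Variable e : R.
Hypothesis e0 : 0 < e.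

Let k (a : R) := expR (- (e * `|a|)).

Lemma continuous_abel1 : continuous k.
Proof.
move=> a; apply: continuous_comp; last exact: continuous_expR.
apply: continuousN; apply: continuousM; first exact: cvg_cst.
exact: norm_continuous.
Qed.

Lemma is_derive_mull (c t : R) : is_derive t 1 (fun t : R => c * t) c.
Proof.
apply: (is_derive_eq (is_deriveZ c (is_derive_id t (1 : R)))).
by rewrite /GRing.scale/= mulr1.
Qed.

(** Antiderivative of [expR (- (e * t)) * (1 + cos (z * t))]. The summand 1 keeps the integrand
    nonnegative, as the half-line fundamental theorem and the symmetry lemma used below demand;
    [k a * cos (z * a)] is recovered as [f z a - k a], and [k] as half of [f 0]. *)
Let F (z t : R) : R := - expR (- (e * t)) / e +
  expR (- (e * t)) * (z * sin (z * t) - e * cos (z * t)) / (e ^+ 2 + z ^+ 2).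

Let dF (z t : R) : is_derive t (1 : R) (F z) (expR (- (e * t)) * (1 + cos (z * t))).
Proof.
have d1 := is_derive_mull e t; have d2 := is_derive_mull z t.
have d3 : is_derive t 1 (fun t : R => expR (- (e * t))) (- e * expR (- (e * t))).
  have dN : is_derive t 1 (fun t : R => - (e * t)) (- e) by exact: (is_deriveN d1).
  have h := @is_derive1_comp _ expR (fun t => - (e * t)) _ _ _ (is_derive_expR (- (e * t))) dN.
  by apply: (is_derive_eq h); rewrite mulrC.
have d4 := @is_derive1_comp _ sin (fun t => z * t) _ _ _ (is_derive_sin (z * t)) d2.
have d5 := @is_derive1_comp _ cos (fun t => z * t) _ _ _ (is_derive_cos (z * t)) d2.
have d6 := is_deriveB (is_deriveZ z d4) (is_deriveZ e d5).
have d7 := is_deriveD (is_deriveZ (- e^-1) d3)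
  (is_deriveZ (e ^+ 2 + z ^+ 2)^-1 (is_deriveM d3 d6)).
have ez : e ^+ 2 + z ^+ 2 != 0 by rewrite gt_eqF// ltr_pwDl ?sqr_ge0// exprn_gt0.
have e1 : e != 0 by rewrite gt_eqF.
have Fe : F z = (- e^-1 *: (fun t : R => expR (- (e * t))) + (e ^+ 2 + z ^+ 2)^-1 *:
    ((fun t : R => expR (- (e * t))) * (z *: (sin \o (fun t : R => z * t)) -
      e *: (cos \o (fun t : R => z * t))))).
  apply/funext => u.
  rewrite -[RHS]/(- e^-1 * expR (- (e * u)) + (e ^+ 2 + z ^+ 2)^-1 *
    (expR (- (e * u)) * (z * sin (z * u) - e * cos (z * u)))).
  by rewrite /F; field; rewrite e1 ez.
rewrite Fe; apply: (is_derive_eq d7).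
rewrite -[LHS]/(- e^-1 * (- e * expR (- (e * t))) + (e ^+ 2 + z ^+ 2)^-1 *
  (expR (- (e * t)) * (z * (cos (z * t) * z) - e * (- sin (z * t) * z)) +
   (z * sin (z * t) - e * cos (z * t)) * (- e * expR (- (e * t))))).
by field; rewrite e1 ez.
Qed.

Let cvg_exp : expR (- (e * t)) @[t --> +oo] --> (0 : R).
Proof.
apply: (@cvg_comp _ _ _ (fun t => e * t) (fun t => expR (- t)) _ (pinfty_nbhs R)).
  exact: gt0_cvgMry.
exact: cvgr_expR.
Qed.

Let cF (z : R) : F z t @[t --> +oo] --> (0 : R).
Proof.
have c0 c : c * expR (- (e * t)) @[t --> +oo] --> (0 : R).
  by rewrite -[X in _ --> X](mulr0 c); apply: cvgM => //; exact: cvg_cst.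
(* Once the exponential is factored out of [F z], the rest is at most [M] in absolute value since
   sine and cosine are bounded by 1. *)
pose M := e^-1 + (`|z| + e) / (e ^+ 2 + z ^+ 2).
have ez : 0 < e ^+ 2 + z ^+ 2 by rewrite ltr_pwDl ?sqr_ge0// exprn_gt0.
apply: (@squeeze_cvgr _ _ _ _ (fun t => - M * expR (- (e * t)))
  (fun t => M * expR (- (e * t)))) => //.
apply: nearW => t; rewrite mulNr -ler_norml /F.
rewrite [X in `|X|](_ : _ = expR (- (e * t)) *
    (- e^-1 + (z * sin (z * t) - e * cos (z * t)) / (e ^+ 2 + z ^+ 2))); last first.
  by field; rewrite !gt_eqF.
rewrite normrM ger0_norm ?expR_ge0// [leRHS]mulrC ler_wpM2l ?expR_ge0//.
rewrite (le_trans (ler_normD _ _))// lerD//.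
  by rewrite normrN ger0_norm// invr_ge0 ltW.
rewrite normrM normfV (gtr0_norm ez) ler_wpM2r ?invr_ge0 1?[0 <= _]ltW//.
rewrite (le_trans (ler_normB _ _))// !normrM (gtr0_norm e0) lerD//.
  by rewrite ler_piMr// sin_norm_le1.
by rewrite ler_piMr// ?cos_norm_le1// ltW.
Qed.

Let f z t := k t * (1 + cos (z * t)).

Let f_ge0 z t : 0 <= f z t.
Proof. by rewrite mulr_ge0 ?expR_ge0//; have := cos_geN1 (z * t); lra. Qed.

Let continuous_f z : continuous (f z).
Proof.
move=> t; apply: cvgM; first exact: continuous_abel1.
apply: cvgD; first exact: cvg_cst.
apply: (@continuous_comp _ _ _ (fun t => z * t) cos); last exact: continuous_cos.
by apply: cvgM => //; exact: cvg_cst.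
Qed.

Let integral_f z : (\int[leb]_t (f z t)%:E)%E =
  (2 * (e^-1 + e / (e ^+ 2 + z ^+ 2)))%:E.
Proof.
(* By evenness the integral is twice that over the half-line, where it equals [- F z 0]. *)
rewrite ge0_symfun_integralT//; last first.
  by move=> t; rewrite /f /k /= normrN mulrN cosN.
rewrite -set_itvcy (ge0_continuous_FTC2y _ _ (@cF z)).
- rewrite /F !mulr0 oppr0 expR0 sin0 cos0 -EFinD -EFinM; congr EFin; field.
  by rewrite !gt_eqF// ltr_pwDl ?sqr_ge0// exprn_gt0.
- by [].
- exact: continuous_subspaceT.
- by move=> t _; case: (dF z t).
- apply: cvg_at_right_filter.
  by apply: differentiable_continuous; apply/derivable1_diffP; case: (dF z 0).
- move=> t; rewrite in_itv/= andbT => t0.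
  rewrite derive1E (@derive_val _ _ _ _ _ _ _ (dF z t)) /f /k gtr0_norm//.
Qed.
Let integrable_f z : leb.-integrable setT (EFin \o f z).
Proof.
apply/integrableP; split.
  by apply/measurable_EFinP; exact: continuous_measurable_fun.
under eq_integral do rewrite gee0_abs ?lee_fin//.
by rewrite integral_f ltry.
Qed.

Lemma integrable_abel1 : leb.-integrable setT (EFin \o k).
Proof.
apply: (integrable_dominated _ (integrable_f 0)).
  by apply: continuous_measurable_fun; exact: continuous_abel1.
move=> x; rewrite ger0_norm ?expR_ge0// /f mul0r cos0 ler_peMr ?expR_ge0//; lra.
Qed.

Lemma Rintegral_abel1_cos z :
  \int[leb]_a (k a * cos (z * a)) = 2 * e / (e ^+ 2 + z ^+ 2).
Proof.
have e1 : e != 0 by rewrite gt_eqF.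
have kE a : k a = 2^-1 * f 0 a by rewrite /f mul0r cos0; field.
have fE a : k a * cos (z * a) = f z a - k a by rewrite /f; ring.
under eq_Rintegral do rewrite fE.
rewrite RintegralB//; last exact: integrable_abel1.
under [X in _ - X]eq_Rintegral do rewrite kE.
rewrite RintegralZl// /Rintegral !integral_f/=.
have ez : e ^+ 2 + z ^+ 2 != 0 by rewrite gt_eqF// ltr_pwDl ?sqr_ge0// exprn_gt0.
by field; rewrite e1 ez.
Qed.

End one_dimensional_kernels.

(** * Decay of Schwartz functions *)

Section weight.
Context {R : realType}.
Local Notation leb := (@lebesgue_measure R).
Local Notation mu := lebesgue_rV.

Let cauchy (a : measurableTypeR R) : R := (1 + a ^+ 2)^-1.

Let cauchy_ge0 a : 0 <= cauchy a.
Proof. by rewrite invr_ge0 addr_ge0// sqr_ge0. Qed.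

Let integral_cauchy : (\int[leb]_a (cauchy a)%:E)%E = pi%:E.
Proof.
rewrite ge0_symfun_integralT//; last 2 first.
- exact: continuous_oneDsqrV.
- by move=> a; rewrite /cauchy /= sqrrN.
by rewrite -set_itvcy integral0y_oneDsqr -EFinM; congr EFin; field.
Qed.

Let integrable_cauchy : leb.-integrable setT (EFin \o cauchy).
Proof.
apply/integrableP; split.
  apply/measurable_EFinP; apply: continuous_measurable_fun.
  exact: continuous_oneDsqrV.
under eq_integral do rewrite gee0_abs ?lee_fin//.
by rewrite integral_cauchy ltry.
Qed.

Variable n : nat.
Implicit Types x y : 'rV[R]_n.

(** An unnormalised product of Cauchy densities; a product form lets its integral reduce to
    dimension one. *)
Definition weight x : R := \prod_i (1 + x ord0 i ^+ 2)^-1.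

Lemma weight_gt0 x : 0 < weight x.
Proof. by apply: prodr_gt0 => i _; rewrite invr_gt0 ltr_pwDl// sqr_ge0. Qed.

Lemma weight_ge0 x : 0 <= weight x.
Proof. exact/ltW/weight_gt0. Qed.

Lemma integrable_weight : (mu n).-integrable setT (EFin \o weight).
Proof. exact: integrable_prod_rV integrable_cauchy n. Qed.

Lemma Rintegral_weight : \int[mu n]_x weight x = pi ^+ n.
Proof.
by rewrite (Rintegral_prod_rV integrable_cauchy) /Rintegral integral_cauchy.
Qed.

Lemma integrable_le_weight (f : 'rV[R]_n -> R) M : measurable_fun setT f ->
  (forall x, `|f x| <= M * weight x) -> (mu n).-integrable setT (EFin \o f).
Proof.
move=> mf fM; apply: integrable_dominated mf _ fM.
exact: (integrableZl measurableT M integrable_weight).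
Qed.

(** Dominated convergence of difference quotients needs a bound at an intermediate point of a unit
    segment in terms of the starting point [x]. *)
Lemma weight_shift x i (t : R) : `|t| <= 1 ->
  weight (x + t *: delta_mx ord0 i) <= 3 * weight x.
Proof.
rewrite ler_norml => /andP[t1 t2]; rewrite /weight (bigD1 i)//= [in leRHS](bigD1 i)//=.
rewrite !mxE !eqxx mulr1.
rewrite mulrA (eq_bigr (fun j => (1 + x ord0 j ^+ 2)^-1)); last first.
  by move=> j ji; rewrite !mxE (negbTE ji) mulr0 addr0.
apply: ler_wpM2r.
  by apply: prodr_ge0 => j _; rewrite invr_ge0 addr_ge0// sqr_ge0.
have p (a : R) : 0 < 1 + a ^+ 2 by rewrite ltr_pwDl// sqr_ge0.
rewrite ler_pdivlMr// mulrC ler_pdivrMr//.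
have tt : t ^+ 2 <= 1 by rewrite expr2; nra.
(* With [a] the i-th coordinate, 3(1 + (a+t)^2) - (1 + a^2) = (a+t)^2 + (a+2t)^2 + 2(1 - t^2), which
   is nonnegative; this explains the constant 3. *)
have := sqr_ge0 (x ord0 i + t); have := sqr_ge0 (x ord0 i + 2 * t).
move: (x ord0 i) => a; rewrite !expr2 in tt *; nra.
Qed.

Definition dominated (h : 'rV[R]_n -> R) :=
  forall a : 'I_n -> nat, exists M : R,
    forall x, `|(\prod_i x ord0 i ^+ a i) * h x| <= M.

Lemma dominated_weight h : dominated h -> exists M, forall x, `|h x| <= M * weight x.
Proof.
move=> dh.
(* The product of the factors 1 + x_i^2 is expanded one factor at a time. The monomial [a] stays
   general because choosing x_j^2 in the factor of index [j] raises its j-th exponent by two. *)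
suff H (s : seq 'I_n) (a : 'I_n -> nat) : exists M, forall x,
    `|(\prod_(i <- s) (1 + x ord0 i ^+ 2)) * ((\prod_i x ord0 i ^+ a i) * h x)| <= M.
  have [M hM] := H (index_enum 'I_n) (fun=> 0%N); exists M => x.
  rewrite /weight prodfV ler_pdivlMr; last first.
    by apply: prodr_gt0 => i _; rewrite ltr_pwDl// sqr_ge0.
  have P0 : 0 <= \prod_i (1 + x ord0 i ^+ 2).
    by apply: prodr_ge0 => i _; rewrite addr_ge0// sqr_ge0.
  have := hM x; rewrite (big1 _ _ (fun i => x ord0 i ^+ 0))// mul1r normrM.
  by rewrite (ger0_norm P0) mulrC.
elim: s a => [|j s IH] a.
  by have [M hM] := dh a; exists M => x; rewrite big_nil mul1r.
have [M1 hM1] := IH a; have [M2 hM2] := IH (fun i => (a i + (i == j).*2)%N).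
exists (M1 + M2) => x; rewrite big_cons mulrDl mul1r mulrDl.
apply: (le_trans (ler_normD _ _)); apply: lerD; first exact: hM1.
apply: le_trans (hM2 x); rewrite le_eqVlt; apply/orP; left; apply/eqP; congr `|_|.
have -> : \prod_i x ord0 i ^+ (a i + (i == j).*2) =
    x ord0 j ^+ 2 * \prod_i x ord0 i ^+ a i.
  rewrite (bigD1 j)//= eqxx exprD mulrAC mulrC; congr (_ * _).
  rewrite [RHS](bigD1 j)//=; congr (_ * _).
  by apply: eq_bigr => i /negbTE ->; rewrite addn0.
by ring.
Qed.

End weight.

(** * Schwartz functions and integrals of their derivatives *)

Section schwartz.
Context {R : realType} {n : nat}.
Local Notation mu := (@lebesgue_rV R n).
Implicit Types f : 'rV[R]_n -> R.

Lemma partials_rcons s i f :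
  partials (rcons s i) f = partials s ('D_(delta_mx ord0 i) f).
Proof. by rewrite /partials foldr_rcons. Qed.

Lemma schwartz_partial i f : schwartz f -> schwartz ('D_(delta_mx ord0 i) f).
Proof.
move=> [sf bf]; split=> [s|a s]; rewrite -partials_rcons.
  exact: sf.
exact: bf.
Qed.

Lemma schwartz_continuous f : schwartz f -> continuous f.
Proof. by move=> [/(_ [::])[]]. Qed.

Lemma schwartz_measurable f : schwartz f -> measurable_fun setT f.
Proof. by move=> /schwartz_continuous; exact: continuous_measurable_rV. Qed.

Lemma schwartz_le_weight f : schwartz f ->
  exists M, forall x, `|f x| <= M * weight x.
Proof. by move=> [_ bf]; apply: dominated_weight => a; exact: (bf a [::]). Qed.

Lemma schwartz_integrable f : schwartz f -> mu.-integrable setT (EFin \o f).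
Proof.
move=> sf; have [M fM] := schwartz_le_weight sf.
exact: integrable_le_weight (schwartz_measurable sf) fM.
Qed.

Lemma schwartz_is_derive f i x (t : R) : schwartz f ->
  is_derive t (1 : R) (fun t => f (x + t *: delta_mx ord0 i))
    ('D_(delta_mx ord0 i) f (x + t *: delta_mx ord0 i)).
Proof.
move=> [/(_ [::])[_ df] _]; set v := delta_mx ord0 i.
have {df} /= df := df (x + t *: v) i.
have E : (fun h : R => h^-1 *: (f (x + (h *: 1 + t) *: v) - f (x + t *: v))) =
         (fun h : R => h^-1 *: (f (h *: v + (x + t *: v)) - f (x + t *: v))).
  apply/funext => h; congr (_ *: (f _ - _)).
  by rewrite /GRing.scale/= mulr1 -/(GRing.scale _ _) scalerDl addrCA.
by split; [rewrite /derivable/= E|rewrite /derive/= E].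
Qed.

Variables (i : 'I_n) (h h' : 'rV[R]_n -> R) (M : R).
Let v : 'rV[R]_n := delta_mx ord0 i.
Hypotheses (ih : mu.-integrable setT (EFin \o h))
  (hM : forall x, `|h' x| <= M * weight x)
  (dh : forall x (t : R),
    is_derive t (1 : R) (fun t => h (x + t *: v)) (h' (x + t *: v))).

(* The integrals of the difference quotients vanish by translation invariance. *)
Lemma Rintegral_partial_eq0 : \int[mu]_x h' x = 0.
Proof.
have mh := integrable_measurable ih.
pose r (k : nat) : R := k.+1%:R^-1.
pose q k x := (r k)^-1 * (h (x + r k *: v) - h x).
have r0 k : 0 < r k by rewrite invr_gt0.
have it k := integrable_translate (r k *: v) ih.
have q0 k : \int[mu]_x q k x = 0.
  rewrite RintegralZl//; last exact: (integrableB measurableT (it k) ih).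
  by rewrite RintegralB// Rintegral_translate// subrr mulr0.
have qh x : q ^~ x @ \oo --> h' x.
  have [dx dE] := dh x 0.
  have {}dx : (fun u : R => u^-1 *: (h (x + (u *: 1 + 0) *: v) - h (x + 0 *: v)))
      @ 0^' --> h' x.
    by rewrite -[in X in _ --> X](addr0 x) -(scale0r v) -dE; exact: dx.
  (* The derivative is a limit over a punctured neighbourhood of 0; it is read along the sequence
     1/(k+1), which never meets 0. *)
  have /(_ r) := (cvgr_dnbhsP _ _ _).1 dx.
  rewrite /q scale0r addr0 => H; have {}H := H (conj (fun k => lt0r_neq0 (r0 k)) cvg_harmonic).
  apply: cvg_trans H; apply: near_eq_cvg; apply: nearW => k.
  by rewrite /GRing.scale/= -/(GRing.scale _ _) mulr1 addr0.
have qM (k : nat) x : `|q k x| <= (3 * M) * weight x.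
  have ct : {within `[0, r k], continuous (fun t : R => h (x + t *: v))}.
    apply: continuous_subspaceT => t; apply: differentiable_continuous.
    by apply/derivable1_diffP; case: (dh x t).
  (* The quotient is a value of [h'] at distance less than [r k], hence less than 1, from [x];
     [weight_shift] then costs the factor 3. *)
  have [c] := MVT (r0 k) (fun t _ => dh x t) ct.
  rewrite in_itv/= => /andP[c0 cr]; rewrite scale0r addr0 subr0 /q => ->.
  rewrite mulrCA mulVf ?mulr1 ?lt0r_neq0//.
  have M0 : 0 <= M by rewrite -(pmulr_lge0 _ (weight_gt0 x)) (le_trans _ (hM x)).
  rewrite (le_trans (hM _))// (mulrC 3) -mulrA ler_wpM2l//; apply: weight_shift.
  rewrite gtr0_norm// (le_trans (ltW cr))// /r invf_le1// ler1n//.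
have mq k : measurable_fun setT (q k).
  apply: measurable_funM => //; apply: measurable_funB => //.
  exact: integrable_measurable (it k).
have := cvg_Rintegral_dominated mq qh
  (integrableZl measurableT (3 * M) (integrable_weight n)) qM.
under eq_fun do rewrite q0.
by move=> /cvg_lim <-//; rewrite lim_cst.
Qed.

End schwartz.

(** * Cosine and sine transforms *)

Section cosine_sine_transforms.
Context {R : realType} {n : nat}.
Local Notation mu := (@lebesgue_rV R n).
Implicit Types (f : 'rV[R]_n -> R) (y : 'rV[R]_n).

Definition cos_transform f y : R := \int[mu]_x (f x * cos (dot y x)).
Definition sin_transform f y : R := \int[mu]_x (f x * sin (dot y x)).

Lemma is_derive_dot_line y x i (t : R) :
  is_derive t (1 : R) (fun t => dot y (x + t *: delta_mx ord0 i)) (y ord0 i).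
Proof.
have -> : (fun t : R => dot y (x + t *: delta_mx ord0 i)) =
    (cst (dot y x) + (fun t => y ord0 i * t)).
  by apply/funext => u; rewrite dotDr dot_delta.
apply: (is_derive_eq (is_deriveD (is_derive_cst _ _ _) (is_derive_mull _ _))).
by rewrite add0r.
Qed.

Section parts.
Variables (f : 'rV[R]_n -> R) (i : 'I_n) (y : 'rV[R]_n).
Hypothesis sf : schwartz f.
Let v : 'rV[R]_n := delta_mx ord0 i.
Let sdf := schwartz_partial i sf.
Let fi := schwartz_integrable sf.
Let dfi := schwartz_integrable sdf.

(* Integration by parts: [c] has directional derivative [y_i s]. *)
Let parts (c s : 'rV[R]_n -> R) :
  measurable_fun setT c -> measurable_fun setT s ->
  (forall x, `|c x| <= 1) -> (forall x, `|s x| <= 1) ->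
  (forall x (t : R), is_derive t (1 : R) (fun t => c (x + t *: v))
    (s (x + t *: v) * y ord0 i)) ->
  \int[mu]_x ('D_v f x * c x) = - (y ord0 i * \int[mu]_x (f x * s x)).
Proof.
move=> mc ms c1 s1 dc.
have [M1 hM1] := schwartz_le_weight sf.
have [M2 hM2] := schwartz_le_weight sdf.
have ifc := integrable_mulr_bounded fi mc c1.
have ifs := integrable_mulr_bounded fi ms s1.
have idfc := integrable_mulr_bounded dfi mc c1.
(* The second function is the product-rule derivative of [f * c] along [v]; its vanishing integral
   is the formula sought. *)
have := @Rintegral_partial_eq0 R n i (fun x => f x * c x)
  (fun x => 'D_v f x * c x + y ord0 i * (f x * s x)) (M2 + `|y ord0 i| * M1) ifc.
rewrite RintegralD//; last exact: (integrableZl measurableT (y ord0 i) ifs).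
rewrite RintegralZl// => H; apply/eqP; rewrite -addr_eq0; apply/eqP; apply: H.
- move=> x; rewrite mulrDl; apply: le_trans (ler_normD _ _) _; apply: lerD.
    by apply: le_trans (hM2 x); rewrite normrM ler_piMr.
  rewrite -mulrA normrM ler_wpM2l//.
  by apply: le_trans (hM1 x); rewrite normrM ler_piMr.
- move=> x t; apply: (is_derive_eq (is_deriveM (schwartz_is_derive i x t sf) (dc x t))).
  rewrite /GRing.scale/=; ring.
Qed.

Lemma cos_transform_partial :
  cos_transform ('D_v f) y = y ord0 i * sin_transform f y.
Proof.
have dc x (t : R) : is_derive t (1 : R) (fun t => cos (dot y (x + t *: v)))
    (- sin (dot y (x + t *: v)) * y ord0 i).
  exact: (@is_derive1_comp _ cos (fun t => dot y (x + t *: v)) _ _ _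
    (is_derive_cos _) (is_derive_dot_line _ _ _ _)).
have ms : measurable_fun setT (fun x => - sin (dot y x)).
  by apply: measurableT_comp => //; exact: measurable_sin_dot.
have s1 x : `|- sin (dot y x)| <= 1 by rewrite normrN sin_norm_le1.
rewrite /cos_transform (parts (measurable_cos_dot y) ms (fun x => cos_norm_le1 _) s1 dc).
under eq_Rintegral do rewrite mulrN -mulN1r.
by rewrite RintegralZl//; [rewrite mulN1r mulrN opprK|exact: integrable_sin_dot].
Qed.

Lemma sin_transform_partial :
  sin_transform ('D_v f) y = - (y ord0 i * cos_transform f y).
Proof.
have dc x (t : R) : is_derive t (1 : R) (fun t => sin (dot y (x + t *: v)))
    (cos (dot y (x + t *: v)) * y ord0 i).
  exact: (@is_derive1_comp _ sin (fun t => dot y (x + t *: v)) _ _ _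
    (is_derive_sin _) (is_derive_dot_line _ _ _ _)).
exact: (parts (measurable_sin_dot y) (measurable_cos_dot y)
  (fun x => sin_norm_le1 _) (fun x => cos_norm_le1 _) dc).
Qed.

End parts.

(** One derivative exchanges the two transforms, so two of them return to the same transform with
    the factor - y_j^2. The summands 1 and y_j^2 of a new factor are handled by the induction
    hypothesis for [f] and for its second derivative, which is why [f] varies. The list [s] is free:
    all indices give decay, the empty list gives mere boundedness. *)
Lemma transform_decay f (s : seq 'I_n) : schwartz f -> exists M, forall y,
  (`|cos_transform f y| * \prod_(i <- s) (1 + y ord0 i ^+ 2) <= M) /\
  (`|sin_transform f y| * \prod_(i <- s) (1 + y ord0 i ^+ 2) <= M).
Proof.
elim: s f => [|j s IH] f sf.
  exists (\int[mu]_x `|f x|) => y; rewrite big_nil !mulr1.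
  have fi := schwartz_integrable sf.
  have ic := integrable_cos_dot fi y; have isn := integrable_sin_dot fi y.
  split; (apply: le_trans (le_normr_Rintegral _ _) _ => //);
    apply: le_Rintegral => //; try exact: integrable_normr.
    by move=> x _; rewrite normrM ler_piMr// cos_norm_le1.
  by move=> x _; rewrite normrM ler_piMr// sin_norm_le1.
pose g := 'D_(delta_mx ord0 j) ('D_(delta_mx ord0 j) f).
have sdf := schwartz_partial j sf.
have [M1 hM1] := IH f sf; have [M2 hM2] := IH g (schwartz_partial j sdf).
exists (M1 + M2) => y.
have [c1 s1] := hM1 y; have [c2 s2] := hM2 y.
have step (a b P : R) : `|b| = y ord0 j ^+ 2 * `|a| -> `|a| * P <= M1 -> `|b| * P <= M2 ->
    `|a| * ((1 + y ord0 j ^+ 2) * P) <= M1 + M2.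
  move=> -> aP bP; apply: le_trans (lerD aP bP).
  by rewrite le_eqVlt; apply/orP; left; apply/eqP; ring.
rewrite big_cons; split.
  apply: step c1 c2; rewrite /g cos_transform_partial// sin_transform_partial//.
  by rewrite mulrN normrN mulrA normrM -expr2 ger0_norm// sqr_ge0.
apply: step s1 s2; rewrite /g sin_transform_partial// cos_transform_partial//.
by rewrite normrN mulrA normrM -expr2 ger0_norm// sqr_ge0.
Qed.

Lemma transform_le_weight f : schwartz f -> exists M, forall y,
  (`|cos_transform f y| <= M * weight y) /\ (`|sin_transform f y| <= M * weight y).
Proof.
move=> sf; have [M hM] := transform_decay (index_enum 'I_n) sf; exists M => y.
have P0 : 0 < \prod_i (1 + y ord0 i ^+ 2).
  by apply: prodr_gt0 => i _; rewrite ltr_pwDl// sqr_ge0.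
by rewrite /weight prodfV !(ler_pdivlMr _ _ P0).
Qed.

(* The factor [weight y] makes the integrand jointly integrable, so that Fubini applies. *)
Let measurable_parameter f (c : R -> R) : mu.-integrable setT (EFin \o f) ->
  measurable_fun setT c -> (forall a, `|c a| <= 1) ->
  measurable_fun setT (fun y => \int[mu]_x (f x * c (dot y x))).
Proof.
move=> fi mc c1.
pose k (p : 'rV[R]_n * 'rV[R]_n) := weight p.1 * f p.2 * c (dot p.1 p.2).
have mc2 : measurable_fun setT (fun p : 'rV[R]_n * 'rV[R]_n => c (dot p.1 p.2)).
  apply: (measurableT_comp mc); apply: measurable_dot2.
    exact: measurable_fst.
  exact: measurable_snd.
have ik := integrable_mulr_bounded
  (integrable_tensor (integrable_weight n) fi) mc2 (fun p => c1 _).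
have ifc y : mu.-integrable setT (EFin \o (fun x => f x * c (dot y x))).
  apply: (integrable_mulr_bounded fi) => //; apply: (measurableT_comp mc).
  exact: measurable_dot2.
have kE y : (fun x => k (y, x)) = (fun x => weight y * (f x * c (dot y x))).
  by apply/funext => x; rewrite /k/= mulrA.
have iky y : mu.-integrable setT (EFin \o (fun x => k (y, x))).
  by rewrite kE; exact: (integrableZl measurableT (weight y) (ifc y)).
have mk := integrable_measurable (integrable_Rintegral2 ik iky).
rewrite (_ : (fun y => _) = (fun y => (\prod_i (1 + y ord0 i ^+ 2)) * \int[mu]_x k (y, x))).
  apply: measurable_funM => //; apply: measurable_prod => i _.
  apply: measurable_funD => //; apply: measurable_funX.
  exact: measurable_coord.
apply/funext => y; rewrite kE RintegralZl// -[X in X * _]invrK -prodfV -/(weight y).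
by rewrite mulKf// lt0r_neq0// weight_gt0.
Qed.

Lemma measurable_cos_transform f : mu.-integrable setT (EFin \o f) ->
  measurable_fun setT (cos_transform f).
Proof.
move=> fi; apply: measurable_parameter => //.
  exact: (continuous_measurable_fun (@continuous_cos R)).
exact: cos_norm_le1.
Qed.

Lemma measurable_sin_transform f : mu.-integrable setT (EFin \o f) ->
  measurable_fun setT (sin_transform f).
Proof.
move=> fi; apply: measurable_parameter => //.
  exact: (continuous_measurable_fun (@continuous_sin R)).
exact: sin_norm_le1.
Qed.

Lemma schwartz_cos_transform_integrable f : schwartz f ->
  mu.-integrable setT (EFin \o cos_transform f).
Proof.
move=> sf; have [M hM] := transform_le_weight sf.
apply: integrable_le_weight (fun y => (hM y).1).
by apply: measurable_cos_transform; exact: schwartz_integrable.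
Qed.

Lemma schwartz_sin_transform_integrable f : schwartz f ->
  mu.-integrable setT (EFin \o sin_transform f).
Proof.
move=> sf; have [M hM] := transform_le_weight sf.
apply: integrable_le_weight (fun y => (hM y).2).
by apply: measurable_sin_transform; exact: schwartz_integrable.
Qed.

Lemma real_fourierE f y : mu.-integrable setT (EFin \o f) ->
  real_fourier f y =
  (Num.sqrt ((2 * pi) ^+ n))^-1 * (cos_transform f y - sin_transform f y).
Proof.
move=> fi; rewrite /real_fourier; under eq_Rintegral do rewrite mulrBr.
by rewrite RintegralB//; [exact: integrable_cos_dot|exact: integrable_sin_dot].
Qed.

Lemma cos_transformN f y : cos_transform f (- y) = cos_transform f y.
Proof. by apply: eq_Rintegral => x _; rewrite dotNl cosN. Qed.

Lemma sin_transformN f y : mu.-integrable setT (EFin \o f) ->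
  sin_transform f (- y) = - sin_transform f y.
Proof.
move=> fi; rewrite /sin_transform.
under eq_Rintegral do rewrite dotNl sinN mulrN -mulN1r.
by rewrite RintegralZl ?mulN1r//; exact: integrable_sin_dot.
Qed.

End cosine_sine_transforms.

(** * Fourier inversion *)

Lemma fourier_constK (R : realType) (n : nat) :
  (Num.sqrt ((2 * pi : R) ^+ n))^-1 ^+ 2 * (2 * pi) ^+ n = 1.
Proof.
have p : 0 < (2 * pi : R) ^+ n by rewrite exprn_gt0// mulr_gt0// pi_gt0.
by rewrite exprVn sqr_sqrtr ?ltW// mulVf// gt_eqF.
Qed.

Section inversion.
Context {R : realType} {n : nat}.
Local Notation mu := (@lebesgue_rV R n).
Implicit Types x t u : 'rV[R]_n.

Definition cas (a : R) := cos a - sin a.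

Lemma cas_norm_le2 a : `|cas a| <= 2.
Proof.
apply: le_trans (ler_normB _ _) _.
by have := cos_norm_le1 a; have := sin_norm_le1 a; lra.
Qed.

Lemma continuous_cas : continuous cas.
Proof. by move=> a; apply: cvgB; [exact: continuous_cos|exact: continuous_sin]. Qed.

Lemma measurable_cas_dot d (T : measurableType d) (f g : T -> 'rV[R]_n) :
  measurable_fun setT f -> measurable_fun setT g ->
  measurable_fun setT (fun p => cas (dot (f p) (g p))).
Proof.
move=> mf mg; apply: (measurableT_comp (continuous_measurable_fun continuous_cas)).
exact: measurable_dot2.
Qed.

Lemma integrable_cas_dot f x : mu.-integrable setT (EFin \o f) ->
  mu.-integrable setT (EFin \o (fun t => f t * cas (dot x t))).
Proof.
move=> fi; apply: (integrable_mulr_bounded fi _ (fun t => cas_norm_le2 _)).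
exact: measurable_cas_dot.
Qed.

Definition abel (e : R) t : R := \prod_i expR (- (e * `|t ord0 i|)).

Lemma abel_ge0 e t : 0 <= abel e t.
Proof. by apply: prodr_ge0 => i _; exact: expR_ge0. Qed.

Lemma abel_le1 e t : 0 <= e -> abel e t <= 1.
Proof.
move=> e0; have -> : 1 = \prod_(i < n) (1 : R) by rewrite big1.
by apply: ler_prod => i _; rewrite expR_ge0/= expR_le1 oppr_le0 mulr_ge0.
Qed.

Lemma cvg_abel0 (e : R^nat) t : e @ \oo --> 0 -> abel (e k) t @[k --> \oo] --> (1 : R).
Proof.
move=> e0; rewrite (_ : 1 = \prod_(i < n) expR (- (0 * `|t ord0 i|))); last first.
  by rewrite big1// => i _; rewrite mul0r oppr0 expR0.
apply: cvg_big => [|i _]; first exact: mul_continuous.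
apply: (@cvg_comp _ _ _ (fun k => - (e k * `|t ord0 i|)) expR); last exact: continuous_expR.
by apply: cvgN; apply: cvgM => //; exact: cvg_cst.
Qed.

Section abel_mean.
Variable e : R.
Hypothesis e0 : 0 < e.

Lemma integrable_abel_rV : mu.-integrable setT (EFin \o abel e).
Proof. exact: integrable_prod_rV (integrable_abel1 e0) n. Qed.

(** Each Poisson factor 2e / (e^2 + z^2) equals (2/e) / (1 + (z/e)^2). *)
Lemma Rintegral_abel_cos_rV x : \int[mu]_t (abel e t * cos (dot x t)) =
  (2 / e) ^+ n * weight (e^-1 *: x).
Proof.
have e1 : e != 0 by rewrite gt_eqF.
rewrite (Rintegral_prod_cos (integrable_abel1 e0) _ (Rintegral_abel1_cos e0)); last first.
  by move=> a; rewrite normrN.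
rewrite -[in (2 / e) ^+ n](card_ord n) -prodr_const -big_split/=.
apply: eq_bigr => i _; rewrite mxE.
by field; rewrite e1 gt_eqF// ltr_pwDl ?sqr_ge0// exprn_gt0.
Qed.

Lemma Rintegral_abel_cas x u :
  \int[mu]_t (abel e t * (cas (dot t u) * cas (dot x t))) =
  (2 / e) ^+ n * weight (e^-1 *: (u - x)).
Proof.
have ia := integrable_abel_rV.
have E t : abel e t * (cas (dot t u) * cas (dot x t)) =
    abel e t * cos (dot (u - x) t) - abel e t * sin (dot (u + x) t).
  rewrite !(dotC _ t) dotBr dotDr cosB sinD /cas; ring.
under eq_Rintegral do rewrite E.
rewrite RintegralB//; [|exact: integrable_cos_dot|exact: integrable_sin_dot].
rewrite Rintegral_abel_cos_rV Rintegral_even_sin_dot ?subr0// => t.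
by apply: eq_bigr => i _; rewrite mxE normrN.
Qed.

Variable g : 'rV[R]_n -> R.
Variable M : R.
Hypotheses (gi : mu.-integrable setT (EFin \o g)) (gM : forall x, `|g x| <= M).

(** The factor [abel e t] makes the double integrand absolutely integrable, so the order can be
    exchanged; the inner integral is then the Poisson kernel centred at [x]. *)
Lemma Rintegral_fourier_abel x :
  \int[mu]_t (real_fourier g t * cas (dot x t) * abel e t) =
  (Num.sqrt ((2 * pi) ^+ n))^-1 * (2 ^+ n * \int[mu]_v (g (x + e *: v) * weight v)).
Proof.
set c := (Num.sqrt _)^-1; have mg := integrable_measurable gi.
have ia := integrable_abel_rV.
pose K (p : 'rV[R]_n * 'rV[R]_n) :=
  abel e p.1 * g p.2 * (cas (dot p.1 p.2) * cas (dot x p.1)).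
have m2 : measurable_fun setT
    (fun p : 'rV[R]_n * 'rV[R]_n => cas (dot p.1 p.2) * cas (dot x p.1)).
  by apply: measurable_funM; apply: measurable_cas_dot.
have b2 t u : `|cas (dot t u) * cas (dot x t)| <= 2 * 2.
  by rewrite normrM ler_pM// cas_norm_le2.
have iac u : mu.-integrable setT
    (EFin \o (fun t => abel e t * (cas (dot t u) * cas (dot x t)))).
  apply: (integrable_mulr_bounded ia _ (fun t => b2 t u)).
  by apply: measurable_funM; apply: measurable_cas_dot.
have iK : (mu \x mu)%E.-integrable setT (EFin \o K).
  exact: (integrable_mulr_bounded (integrable_tensor ia gi) m2 (fun p => b2 _ _)).
have iK2 t : mu.-integrable setT (EFin \o (fun u => K (t, u))).
  have -> : (fun u => K (t, u)) =
      (fun u => (abel e t * cas (dot x t)) * (g u * cas (dot t u))).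
    by apply/funext => u; rewrite /K/=; ring.
  exact: (integrableZl measurableT _ (integrable_cas_dot t gi)).
have iK1 u : mu.-integrable setT (EFin \o (fun t => K (t, u))).
  have -> : (fun t => K (t, u)) =
      (fun t => g u * (abel e t * (cas (dot t u) * cas (dot x t)))).
    by apply/funext => t; rewrite /K/=; ring.
  exact: (integrableZl measurableT (g u) (iac u)).
have KE t : real_fourier g t * cas (dot x t) * abel e t = c * \int[mu]_u K (t, u).
  rewrite /real_fourier -/c -!mulrA; congr (_ * _).
  rewrite mulrC -RintegralZl//; last exact: integrable_cas_dot.
  by apply: eq_Rintegral => u _; rewrite /K/= /cas; ring.
under eq_Rintegral do rewrite KE.
rewrite RintegralZl//; last exact: integrable_Rintegral2.
congr (_ * _); rewrite Rintegral_Fubini//.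
have e1 : e != 0 by rewrite gt_eqF.
have iw : mu.-integrable setT (EFin \o (fun u => weight (e^-1 *: (u - x)))).
  apply: eq_integrable (integrable_affine_rV (- (e^-1 *: x))
    (invr_neq0 e1) (integrable_weight n)) => // u _ /=.
  by rewrite scalerBr addrC.
have igw := integrable_mulr_bounded iw mg gM.
rewrite (@eq_Rintegral _ _ _ _ _
  (fun u => (2 / e) ^+ n * (weight (e^-1 *: (u - x)) * g u))); last first.
  move=> u _; rewrite mulrA -(Rintegral_abel_cas x u) -RintegralZr//.
  by apply: eq_Rintegral => t _; rewrite /K/=; ring.
(* Substituting u = x + e v produces e^n, which turns (2/e)^n into 2^n and moves all dependence on
   [e] into the argument of [g]. *)
rewrite RintegralZl// -(Rintegral_affine_rV x e1 igw) (gtr0_norm e0) mulrA -exprMn divfK//.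
congr (_ * _); apply: eq_Rintegral => v _.
by rewrite addrAC subrr add0r scalerA mulVf// scale1r mulrC.
Qed.

End abel_mean.

(** The same sequence of Abel means has two limits. On the Fourier side the majorant is the undamped
    integrand, as [abel] is at most 1; on the Poisson side it is [M] times [weight], with pointwise
    convergence from continuity of [g]. *)
Theorem real_fourier_involutive (g : 'rV[R]_n -> R) (M : R) : continuous g ->
  mu.-integrable setT (EFin \o g) -> (forall x, `|g x| <= M) ->
  mu.-integrable setT (EFin \o real_fourier g) ->
  real_fourier (real_fourier g) = g.
Proof.
move=> cg gi gM Gi; apply/funext => x.
pose r (k : nat) : R := k.+1%:R^-1.
have r0 k : 0 < r k by rewrite invr_gt0.
have cr : r @ \oo --> 0 by exact: cvg_harmonic.
set c := (Num.sqrt ((2 * pi : R) ^+ n))^-1.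
have iG := integrable_cas_dot x Gi.
have lhs : \int[mu]_t (real_fourier g t * cas (dot x t) * abel (r k) t) @[k --> \oo]
    --> \int[mu]_t (real_fourier g t * cas (dot x t)).
  apply: (cvg_Rintegral_dominated _ _ (integrable_normr iG)) => [k|t|k t].
  - apply: measurable_funM; first exact: integrable_measurable iG.
    exact: integrable_measurable (integrable_abel_rV (r0 k)).
  - rewrite -[X in _ --> X]mulr1; apply: cvgM; first exact: cvg_cst.
    exact: cvg_abel0.
  - by rewrite normrM ler_piMr// ger0_norm ?abel_ge0// abel_le1// ltW.
have rhs : \int[mu]_v (g (x + r k *: v) * weight v) @[k --> \oo]
    --> \int[mu]_v (g x * weight v).
  apply: (cvg_Rintegral_dominated _ _
    (integrableZl measurableT M (integrable_weight n))) => [k|t|k t].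
  - apply: measurable_funM; last exact: integrable_measurable (integrable_weight n).
    exact: (measurableT_comp (integrable_measurable gi) (@measurable_affine_rV _ _ x (r k))).
  - apply: cvgM; last exact: cvg_cst.
    have cx : x + r k *: t @[k --> \oo] --> x.
      rewrite -[X in _ --> X]addr0 -(scale0r t); apply: cvgD; first exact: cvg_cst.
      by apply: cvgZ => //; exact: cvg_cst.
    exact: (cvg_comp _ _ cx (cg x)).
  - by rewrite /= normrM (ger0_norm (weight_ge0 t)) ler_wpM2r// weight_ge0.
have {}rhs : \int[mu]_t (real_fourier g t * cas (dot x t) * abel (r k) t) @[k --> \oo]
    --> c * (2 ^+ n * \int[mu]_v (g x * weight v)).
  under eq_fun do rewrite (Rintegral_fourier_abel (r0 _) gi gM).
  by apply: cvgM; [exact: cvg_cst|apply: cvgM => //; exact: cvg_cst].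
rewrite {1}/real_fourier -/c -[X in c * X]/(\int[mu]_t (real_fourier g t * cas (dot x t))).
rewrite (cvg_unique _ lhs rhs)// RintegralZl//; last exact: integrable_weight.
transitivity (g x * (c ^+ 2 * (2 * pi) ^+ n)); last by rewrite fourier_constK mulr1.
by rewrite Rintegral_weight exprMn; move: (2 ^+ n) (pi ^+ n) => a b; ring.
Qed.

End inversion.

(** * Convolution and product *)

Section convolution_theorem.
Context {R : realType} {n : nat}.
Local Notation mu := (@lebesgue_rV R n).
Local Notation c := (Num.sqrt ((2 * pi : R) ^+ n))^-1.
Variables f g : 'rV[R]_n -> R.
Hypotheses (fi : mu.-integrable setT (EFin \o f)) (gi : mu.-integrable setT (EFin \o g)).

Let K (p : 'rV[R]_n * 'rV[R]_n) := f (p.1 - p.2) * g p.2.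

Let iK1 t : mu.-integrable setT (EFin \o (fun x => K (x, t))).
Proof.
have -> : (fun x => K (x, t)) = (fun x => g t * f (x - t)).
  by apply/funext => x; rewrite /K mulrC.
exact: (integrableZl measurableT (g t) (integrable_translate (- t) fi)).
Qed.

(** Integrating in the first variable first, translation invariance leaves [|g t|] times the L1 norm
    of [f]. *)
Lemma integrable_convolution_kernel : (mu \x mu)%E.-integrable setT (EFin \o K).
Proof.
have mf := integrable_measurable fi; have mg := integrable_measurable gi.
apply/integrable21ltyP.
  apply/measurable_EFinP; apply: measurable_funM; last first.
    exact: (measurableT_comp mg measurable_snd).
  apply: (measurableT_comp mf); apply/measurable_fun_rVP => j.
  under eq_fun do rewrite !mxE.
  apply: measurable_funB.
    exact: (measurableT_comp (measurable_coord j) measurable_fst).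
  exact: (measurableT_comp (measurable_coord j) measurable_snd).
have E t : (\int[mu]_x `|(K (x, t))%:E|)%E = (`|g t| * \int[mu]_x `|f x|)%:E.
  have ifn := integrable_normr fi.
  rewrite -(Rintegral_translate (- t) ifn) -RintegralZl//; last first.
    exact: (integrable_translate (- t) ifn).
  rewrite EFin_Rintegral; last first.
    exact: (integrableZl measurableT `|g t| (integrable_translate (- t) ifn)).
  by apply: eq_integral => x _ /=; rewrite normrM mulrC.
under eq_integral do rewrite E.
rewrite -EFin_Rintegral ?ltry//.
under eq_fun do rewrite mulrC.
exact: (integrableZl measurableT (\int[mu]_x `|f x|) (integrable_normr gi)).
Qed.

(** The right side comes from cas(a + b) = cos b cas a - sin b (cos a + sin a). A bound on [f] makes
    every section of the kernel integrable, as the pointwise form of Fubini asks. *)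
Lemma real_fourier_convolution y : (exists M, forall x, `|f x| <= M) ->
  real_fourier (convolution f g) y =
  c * ((cos_transform f y - sin_transform f y) * cos_transform g y
       - (cos_transform f y + sin_transform f y) * sin_transform g y).
Proof.
move=> [M fM]; have mf := integrable_measurable fi.
pose H (p : 'rV[R]_n * 'rV[R]_n) := K p * cas (dot y p.1).
have iK2 x : mu.-integrable setT (EFin \o (fun t => K (x, t))).
  have -> : (fun t => K (x, t)) = (fun t => g t * f (x - t)).
    by apply/funext => t; rewrite /K mulrC.
  have mfx := integrable_measurable (integrable_reflect x fi).
  exact: (integrable_mulr_bounded gi mfx (fun t => fM (x - t))).
have iH : (mu \x mu)%E.-integrable setT (EFin \o H).
  apply: (integrable_mulr_bounded integrable_convolution_kernel _ (fun p => cas_norm_le2 _)).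
  exact: measurable_cas_dot.
have iH2 x : mu.-integrable setT (EFin \o (fun t => H (x, t))).
  have -> : (fun t => H (x, t)) = (fun t => cas (dot y x) * K (x, t)).
    by apply/funext => t; rewrite /H mulrC.
  exact: (integrableZl measurableT _ (iK2 x)).
have iH1 t : mu.-integrable setT (EFin \o (fun x => H (x, t))).
  exact: integrable_cas_dot (iK1 t).
rewrite /real_fourier; congr (_ * _).
transitivity (\int[mu]_x \int[mu]_t H (x, t)).
  by apply: eq_Rintegral => x _; rewrite /convolution -RintegralZr//; exact: iK2.
rewrite Rintegral_Fubini//.
have ic := integrable_cos_dot fi y; have isn := integrable_sin_dot fi y.
transitivity (\int[mu]_t (
    (cos_transform f y - sin_transform f y) * (g t * cos (dot y t))
    - (cos_transform f y + sin_transform f y) * (g t * sin (dot y t)))).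
  apply: eq_Rintegral => t _.
  have icas : mu.-integrable setT (EFin \o (fun u => f u * cas (dot y (u + t)))).
    have mt : measurable_fun setT (fun u : 'rV[R]_n => u + t).
      have := @measurable_affine_rV _ _ t 1.
      by under eq_fun do rewrite scale1r addrC.
    apply: (integrable_mulr_bounded fi _ (fun u => cas_norm_le2 _)).
    exact: (measurable_cas_dot (measurable_cst y) mt).
  (* Writing x as (x - t) + t makes the integrand a function of x - t, ready for translation. *)
  transitivity (g t * \int[mu]_x (f (x - t) * cas (dot y (x - t + t)))).
    rewrite -RintegralZl//; last exact: (integrable_translate (- t) icas).
    by apply: eq_Rintegral => x _; rewrite subrK /H /K/=; ring.
  rewrite (Rintegral_translate (- t) icas).
  have E u : f u * cas (dot y (u + t)) =
      (f u * cos (dot y u) * (cos (dot y t) - sin (dot y t))) -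
      (f u * sin (dot y u) * (cos (dot y t) + sin (dot y t))).
    rewrite /cas dotDr cosD sinD; ring.
  under eq_Rintegral do rewrite E.
  rewrite RintegralB//; [|exact: (integrableZr measurableT _ ic)|
    exact: (integrableZr measurableT _ isn)].
  rewrite !RintegralZr// -/(cos_transform f y) -/(sin_transform f y); ring.
have igc := integrable_cos_dot gi y; have igs := integrable_sin_dot gi y.
rewrite RintegralB//; [|exact: (integrableZl measurableT _ igc)|
  exact: (integrableZl measurableT _ igs)].
by rewrite !RintegralZl.
Qed.

End convolution_theorem.

Section product_theorem.
Context {R : realType} {n : nat}.
Local Notation mu := (@lebesgue_rV R n).
Local Notation c := (Num.sqrt ((2 * pi : R) ^+ n))^-1.
Implicit Types f g : 'rV[R]_n -> R.

Lemma schwartz_real_fourier_le f : schwartz f ->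
  exists M, forall y, `|real_fourier f y| <= M.
Proof.
move=> sf; have [M hM] := transform_decay [::] sf; exists (c * (M + M)) => y.
rewrite real_fourierE; last exact: schwartz_integrable.
have [c1 s1] := hM y; rewrite big_nil !mulr1 in c1 s1.
rewrite normrM ger0_norm ?invr_ge0 ?sqrtr_ge0// ler_wpM2l ?invr_ge0 ?sqrtr_ge0//.
by apply: le_trans (ler_normB _ _) _; exact: lerD.
Qed.

Lemma schwartz_real_fourier_integrable f : schwartz f ->
  mu.-integrable setT (EFin \o real_fourier f).
Proof.
move=> sf; have fi := schwartz_integrable sf.
rewrite (_ : real_fourier f = (fun y => c * (cos_transform f y - sin_transform f y))).
  have ic := schwartz_cos_transform_integrable sf.
  have isn := schwartz_sin_transform_integrable sf.
  exact: (integrableZl measurableT c (integrableB measurableT ic isn)).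
by apply/funext => y; rewrite real_fourierE.
Qed.

Lemma schwartz_bounded f : schwartz f -> exists M, forall x, `|f x| <= M.
Proof.
move=> [_ /(_ (fun=> 0%N) [::])[M hM]]; exists M => x.
by have := hM x; rewrite big1 ?mul1r// => i _; rewrite expr0.
Qed.

Lemma real_fourier_mul f g y : schwartz f -> schwartz g ->
  real_fourier (f * g) y =
  c ^+ 2 * \int[mu]_t (real_fourier g t *
    (cos_transform f (y - t) - sin_transform f (y + t))).
Proof.
move=> sf sg; have fi := schwartz_integrable sf; have gi := schwartz_integrable sg.
have Gi := schwartz_real_fourier_integrable sg.
set G := real_fourier g in Gi *.
have [M gM] := schwartz_bounded sg.
have gE := real_fourier_involutive (schwartz_continuous sg) gi gM Gi.
pose H (p : 'rV[R]_n * 'rV[R]_n) := f p.1 * G p.2 * (cas (dot p.1 p.2) * cas (dot y p.1)).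
have m2 : measurable_fun setT
    (fun p : 'rV[R]_n * 'rV[R]_n => cas (dot p.1 p.2) * cas (dot y p.1)).
  by apply: measurable_funM; apply: measurable_cas_dot.
have b2 (t x : 'rV[R]_n) : `|cas (dot x t) * cas (dot y x)| <= 2 * 2.
  by rewrite normrM ler_pM// cas_norm_le2.
have iH : (mu \x mu)%E.-integrable setT (EFin \o H).
  exact: (integrable_mulr_bounded (integrable_tensor fi Gi) m2 (fun p => b2 _ _)).
have iH2 x : mu.-integrable setT (EFin \o (fun t => H (x, t))).
  have -> : (fun t => H (x, t)) =
      (fun t => (f x * cas (dot y x)) * (G t * cas (dot x t))).
    by apply/funext => t; rewrite /H/=; ring.
  exact: (integrableZl measurableT _ (integrable_cas_dot x Gi)).
have iH1 t : mu.-integrable setT (EFin \o (fun x => H (x, t))).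
  have -> : (fun x => H (x, t)) =
      (fun x => G t * (f x * (cas (dot x t) * cas (dot y x)))).
    by apply/funext => x; rewrite /H/=; ring.
  have m1 : measurable_fun setT (fun x => cas (dot x t) * cas (dot y x)).
    by apply: measurable_funM; apply: measurable_cas_dot.
  exact: (integrableZl measurableT (G t) (integrable_mulr_bounded fi m1 (b2 t))).
have HE x : f x * g x * (cos (dot y x) - sin (dot y x)) = c * \int[mu]_t H (x, t).
  rewrite -[in LHS]gE -/G /real_fourier mulrCA -!mulrA; congr (_ * _).
  rewrite mulrC -mulrA mulrC -RintegralZl//; last exact: integrable_cas_dot.
  by apply: eq_Rintegral => t _; rewrite /H/= /cas; ring.
rewrite expr2 -mulrA {1}/real_fourier; congr (_ * _).
under eq_Rintegral do rewrite HE.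
rewrite RintegralZl//; last exact: integrable_Rintegral2.
congr (_ * _); rewrite Rintegral_Fubini//.
apply: eq_Rintegral => t _.
(* The product formula for [cas], now with the phases grouped around [x], gives the cosine transform
   of [f] at y - t and its sine transform at y + t. *)
have E x : H (x, t) = G t * (f x * cos (dot (y - t) x) - f x * sin (dot (y + t) x)).
  rewrite /H/= /cas !(dotC _ x) dotBr dotDr cosB sinD; ring.
under eq_Rintegral do rewrite E.
have ic := integrable_cos_dot fi (y - t); have isn := integrable_sin_dot fi (y + t).
by rewrite RintegralZl// ?RintegralB//; exact: (integrableB measurableT ic isn).
Qed.

End product_theorem.

Theorem proposition5 (R : realType) (n : nat) (f g : 'rV[R]_n -> R) :
  (1 <= n)%N -> schwartz f -> schwartz g ->
  (Num.sqrt ((2 * pi) ^+ n))^-1 *: real_fourier (convolution f g) =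
    2^-1 *: (real_fourier f * real_fourier g
             + real_fourier f * parity (real_fourier g)
             + parity (real_fourier f) * real_fourier g
             - parity (real_fourier f) * parity (real_fourier g))
  /\
  real_fourier (f * g) =
    ((Num.sqrt ((2 * pi) ^+ n))^-1 * 2^-1) *:
      (convolution (real_fourier f) (real_fourier g)
       + convolution (real_fourier f) (parity (real_fourier g))
       + convolution (parity (real_fourier f)) (real_fourier g)
       - convolution (parity (real_fourier f)) (parity (real_fourier g))).
Proof.
move=> _ sf sg; have fi := schwartz_integrable sf; have gi := schwartz_integrable sg.
set c := (Num.sqrt _)^-1; set F := real_fourier f; set G := real_fourier g.
have FE y : F y = c * (cos_transform f y - sin_transform f y) by exact: real_fourierE.
have GE y : G y = c * (cos_transform g y - sin_transform g y) by exact: real_fourierE.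
(* Parity only flips the sine part, so [F] and its reflection carry the same information as the two
   transforms; the first identity becomes polynomial algebra in four quantities. *)
have PFE y : F (- y) = c * (cos_transform f y + sin_transform f y).
  by rewrite FE cos_transformN sin_transformN// opprK.
have PGE y : G (- y) = c * (cos_transform g y + sin_transform g y).
  by rewrite GE cos_transformN sin_transformN// opprK.
split; apply/funext => y.
  rewrite -[LHS]/(c * real_fourier (convolution f g) y).
  rewrite -[RHS]/(2^-1 * (F y * G y + F y * G (- y) + F (- y) * G y - F (- y) * G (- y))).
  rewrite (real_fourier_convolution fi gi y (schwartz_bounded sf)) -/c.
  by rewrite PFE PGE FE GE; field.
have Fi : (lebesgue_rV n).-integrable setT (EFin \o F).
  exact: schwartz_real_fourier_integrable.
have Gi : (lebesgue_rV n).-integrable setT (EFin \o G).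
  exact: schwartz_real_fourier_integrable.
have [M FM] := schwartz_real_fourier_le sf.
have iFG (a : 'rV[R]_n) (s : R) (z : 'rV[R]_n -> 'rV[R]_n) : (forall t, z t = a + s *: t) ->
    (lebesgue_rV n).-integrable setT (EFin \o (fun t => F (z t) * G t)).
  move=> zE; under eq_fun do rewrite zE mulrC.
  have mF := measurableT_comp (integrable_measurable Fi) (@measurable_affine_rV _ _ a s).
  exact: (integrable_mulr_bounded Gi mF (fun t => FM _)).
have i1 : (lebesgue_rV n).-integrable setT (EFin \o (fun t => F (y - t) * G t)).
  by apply: (iFG y (-1)) => t; rewrite scaleN1r.
have i2 : (lebesgue_rV n).-integrable setT (EFin \o (fun t => F (- (y - t)) * G t)).
  by apply: (iFG (- y) 1) => t; rewrite scale1r opprB addrC.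
have i3 : (lebesgue_rV n).-integrable setT (EFin \o (fun t => F (y + t) * G t)).
  by apply: (iFG y 1) => t; rewrite scale1r.
have i4 : (lebesgue_rV n).-integrable setT (EFin \o (fun t => F (- (y + t)) * G t)).
  by apply: (iFG (- y) (-1)) => t; rewrite scaleN1r opprD.
rewrite -[RHS]/(c * 2^-1 * (convolution F G y + convolution F (parity G) y +
  convolution (parity F) G y - convolution (parity F) (parity G) y)).
(* The reflection t -> -t moves the parity off [G], so that all four convolutions share the factor
   [G t]. *)
have -> : convolution F (parity G) y = \int[lebesgue_rV n]_t (F (y + t) * G t).
  rewrite -(Rintegral_reflect 0 i3).
  by apply: eq_Rintegral => t _; rewrite sub0r.
have -> : convolution (parity F) (parity G) y =
    \int[lebesgue_rV n]_t (F (- (y + t)) * G t).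
  rewrite -(Rintegral_reflect 0 i4).
  by apply: eq_Rintegral => t _; rewrite sub0r.
rewrite /convolution /parity.
rewrite -RintegralD// -RintegralD//; last exact: (integrableD measurableT i1 i3).
have i132 := integrableD measurableT (integrableD measurableT i1 i3) i2.
rewrite -RintegralB// real_fourier_mul// -/c -/G expr2 -!mulrA; congr (_ * _).
have c0 : c != 0 by rewrite invr_neq0// sqrtr_eq0 -ltNge exprn_gt0// mulr_gt0// pi_gt0.
under eq_Rintegral => t _.
  (* F(u) + F(-u) is 2c times the cosine transform and F(u) - F(-u) is -2c times the sine transform,
     used at u = y - t and u = y + t respectively. *)
  rewrite (_ : _ * _ = (2 * c)^-1 * (F (y - t) * G t + F (y + t) * G t
    + F (- (y - t)) * G t - F (- (y + t)) * G t)); last first.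
    by rewrite !PFE !FE; field.
over.
rewrite RintegralZl//; last exact: (integrableB measurableT i132 i4).
by rewrite mulrA; congr (_ * _); field.
Qed.
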